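(* Let $p\geq 3$ be a prime, let $\phi(x)=\frac{ax+b}{cx+d}$ with $a,b,c,d\in\mathbb{Q}_p$, $ad-bc\ne0$, let $\Delta=(d-a)^2+4bc$ with $\sqrt{\Delta}\notin\mathbb{Q}_p$, and suppose that $\lambda=\frac{a+d+\sqrt{\Delta}}{a+d-\sqrt{\Delta}}$ is not a root of unity and that $\mathbb{Q}_p(\sqrt{\Delta})$ is a ramified quadratic extension of $\mathbb{Q}_p$. Let $r_0=|\sqrt{\Delta}/c|_p$, let $\eta\in\mathbb{Q}_p$ with $|\eta|_p=p^{-1/2}r_0$, and set $h(x)=\eta x+\frac{a-d}{2c}$. If $(B,\phi)$ is a minimal subsystem of $(\mathbb{P}^1(\mathbb{Q}_p),\phi)$, then the unique invariant (Borel probability) measure $\overline\sigma$ of the system $(B,\phi)$ is given, for each measurable subset $A\subset B$, by $$\overline\sigma(A)=\frac{\overline\mu(h^{-1}(A))}{\overline\mu(h^{-1}(B))}.$$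
   Context: $\mathbb{P}^1(\mathbb{Q}_p)=\mathbb{Q}_p\cup\{\infty\}$ with its usual compact topology; $|\cdot|_p$ is extended to $\mathbb{Q}_p(\sqrt\Delta)$; $h$ is extended to $\mathbb{P}^1(\mathbb{Q}_p)$ by $h(\infty)=\infty$. (The hypothesis $\sqrt\Delta\notin\mathbb{Q}_p$ forces $c\ne 0$.) A subsystem is a pair $(B,\phi)$ with $B$ nonempty compact and $\phi(B)\subset B$; it is minimal if $B=\overline{\{\phi^n(x):n\ge0\}}$ for every $x\in B$. Let $\mu_0$ be the Haar probability measure on $\mathbb{Z}_p$ and $\xi:\mathbb{P}^1(\mathbb{Q}_p)\to\mathbb{P}^1(\mathbb{Q}_p)$, $\xi(z)=1/z$. For a Borel set $S\subset\mathbb{P}^1(\mathbb{Q}_p)$ put $S_1=\mathbb{Z}_p\cap S$, $S_2=(\mathbb{P}^1(\mathbb{Q}_p)\setminus\mathbb{Z}_p)\cap S$ (so $\xi^{-1}(S_2)\subset p\mathbb{Z}_p$), and define the probability measure $$\overline\mu(S):=\frac12\mu_0(S_1)+\frac p2\,\mu_0(\xi^{-1}(S_2)).$$ *)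

(* Defs.v *)
From HB Require Import structures.
From mathcomp Require Import all_boot all_order all_algebra all_field.
From mathcomp Require Import all_classical all_reals all_analysis.

Set Implicit Arguments.
Unset Strict Implicit.
Unset Printing Implicit Defensive.

Import Order.TTheory GRing.Theory Num.Theory.

Local Open Scope classical_set_scope.
Local Open Scope ring_scope.

(* The p-adic absolute value p ^ (- v_p q) of a rational number q. *)
Definition rat_padic_abs (R : realType) (p : nat) (q : rat) : R :=
  if q == 0 then 0
  else p%:R ^+ logn p `|denq q|%N / p%:R ^+ logn p `|numq q|%N.

Definition ultrametric_abs (R : realType) (F : fieldType) (v : F -> R) : Prop :=
  [/\ forall x, 0 <= v x,
      forall x, v x = 0 <-> x = 0,
      forall x y, v (x * y) = v x * v y
    & forall x y, v (x + y) <= Num.max (v x) (v y)].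

(* Q_p as the completion of (Q, |.|_p): a field complete for an ultrametric
   absolute value, in which Q is dense and which induces |.|_p on Q. This
   determines (Q_p, |.|_p) up to a unique isometric isomorphism. *)
HB.mixin Record isPadicField (R : realType) (p : nat) K & GRing.Field K := {
  padic_abs : K -> R;
  padic_abs_ultrametric : ultrametric_abs padic_abs;
  padic_abs_rat : forall q : rat, padic_abs (ratr q) = rat_padic_abs R p q;
  padic_rat_dense : forall (x : K) (e : R), 0 < e ->
    exists q : rat, padic_abs (x - ratr q) < e;
  padic_complete : forall u : nat -> K,
    (forall e : R, 0 < e -> exists N : nat, forall m n : nat,
       (N <= m)%N -> (N <= n)%N -> padic_abs (u m - u n) < e) ->
    exists l : K, forall e : R, 0 < e -> exists N : nat, forall n : nat,
       (N <= n)%N -> padic_abs (u n - l) < e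
}.

#[short(type="padicFieldType")]
HB.structure Definition PadicField (R : realType) (p : nat) :=
  {K of GRing.Field K & isPadicField R p K}.

Section PadicMetric.
Variables (R : realType) (p : nat) (K : padicFieldType R p).

Let dist (x y : K) : R := padic_abs (x - y).

Let distxx x : dist x x = 0.
Proof.
by rewrite /dist subrr; have [_ H _ _] := @padic_abs_ultrametric R p K; apply/H.
Qed.

Let dist_eq0 x y : dist x y = 0 -> x = y.
Proof.
have [_ H _ _] := @padic_abs_ultrametric R p K.
by move/H/eqP; rewrite subr_eq0 => /eqP.
Qed.

Let distC x y : dist x y = dist y x.
Proof.
have [pos H mul _] := @padic_abs_ultrametric R p K.
have abs1 : padic_abs (1 : K) = 1.
  have n0 : padic_abs (1 : K) != 0 by apply/eqP => /H /eqP; rewrite oner_eq0.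
  by apply: (mulIf n0); rewrite mul1r -mul mulr1.
have absN1 : padic_abs (-1 : K) = 1.
  apply/eqP; rewrite -(@eqrXn2 _ 2%N) ?pos ?ler01 //.
  by rewrite expr1n expr2 -mul mulrNN mulr1 abs1.
by rewrite /dist -opprB -mulN1r mul absN1 mul1r.
Qed.

Let dist_triangle y x z : dist x z <= dist x y + dist y z.
Proof.
have [pos _ _ ultra] := @padic_abs_ultrametric R p K.
rewrite /dist; have -> : x - z = (x - y) + (y - z) by rewrite addrA subrK.
apply: (le_trans (ultra _ _)).
by rewrite ge_max lerDl lerDr !pos.
Qed.

HB.instance Definition _ := isPointed.Build (PadicField.sort K) 0.

HB.instance Definition _ := @isMetric.Build R (PadicField.sort K)
  dist distxx dist_eq0 distC dist_triangle.

Lemma padic_ballE (x : K) (e : R) :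
  ball x e = [set y : K | padic_abs (x - y) < e].
Proof. by []. Qed.

Lemma nbhs_padicP (x : K) (A : set K) :
  nbhs x A <->
  exists2 e : R, 0 < e & [set y : K | padic_abs (x - y) < e] `<=` A.
Proof. by rewrite -nbhs_ballE. Qed.

End PadicMetric.

Definition borel (T : ptopologicalType) := g_sigma_algebraType (@open T).

Section ProjectiveLine.
Variables (R : realType) (p : nat) (K : padicFieldType R p).

Definition padic_integers : set K := [set x | padic_abs x <= 1].

Definition proj_line := one_point_compactification K.

Definition infty : proj_line := None.

Definition affine (x : K) : proj_line := Some x.

(* z |-> (a z + b) / (c z + d) *)
Definition mobius (a b c d : K) (z : proj_line) : proj_line :=
  match z with
  | Some x => if c * x + d == 0 then infty
              else affine ((a * x + b) / (c * x + d))
  | None => if c == 0 then infty else affine (a / c)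
  end.

(* z |-> u z + v, fixing infty *)
Definition affine_map (u v : K) (z : proj_line) : proj_line :=
  match z with
  | Some x => affine (u * x + v)
  | None => infty
  end.

Definition inversion (z : proj_line) : proj_line :=
  match z with
  | Some x => if x == 0 then infty else affine x^-1
  | None => affine 0
  end.

Definition minimal_subsystem (phi : proj_line -> proj_line)
    (B : set proj_line) : Prop :=
  [/\ B !=set0, compact B, phi @` B `<=` B
    & forall x, B x -> B = closure [set iter n phi x | n in [set: nat]]].

(* A Borel probability measure on B is encoded as one on the whole line
   carried by B. *)
Definition invariant_probability (phi : proj_line -> proj_line)
    (B : set proj_line) (sigma : probability (borel proj_line) R) : Prop :=
  sigma B = 1%E /\
  forall A : set (borel proj_line), measurable A -> A `<=` B ->
    sigma (B `&` phi @^-1` A) = sigma A.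

(* The Haar probability measure of the group Z_p, as a measure on Q_p carried
   by Z_p. *)
Definition haar_probability (mu0 : probability (borel K) R) : Prop :=
  mu0 padic_integers = 1%E /\
  forall (z : K) (A : set (borel K)), padic_integers z -> measurable A ->
    A `<=` padic_integers -> mu0 [set (z + x : K) | x in A] = mu0 A.

(* Sets S1 and inversion @^-1` S2 are subsets of K inside the projective line
   (infty is not in the latter as inversion infty = 0 is in Z_p), so that
   their measure is that of their preimage by affine. *)
Definition mu_bar (mu0 : probability (borel K) R) (S : set proj_line) : \bar R :=
  let Zp := affine @` padic_integers in
  let S1 := Zp `&` S in
  let S2 := ~` Zp `&` S in
  ((2^-1 : R)%:E * mu0 (affine @^-1` S1) +
   (p%:R / 2 : R)%:E * mu0 (affine @^-1` (inversion @^-1` S2)))%E.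

End ProjectiveLine.

(* absL extends the p-adic absolute value to L. *)
Definition extends_padic_abs (R : realType) (p : nat) (K : padicFieldType R p)
    (L : fieldExtType K) (absL : L -> R) : Prop :=
  ultrametric_abs absL /\ forall x : K, absL x%:A = padic_abs x.

(* The ramification index, i.e. the index of the value group of K in that
   of L, is not 1. *)
Definition ramified (R : realType) (p : nat) (K : padicFieldType R p)
    (L : fieldExtType K) (absL : L -> R) : Prop :=
  exists2 y : L, y != 0 & forall x : K, absL y != padic_abs x.

(* Main.v *)
Require Import Defs.
From HB Require Import structures.
From mathcomp Require Import finmap.
From mathcomp Require Import all_boot all_order all_algebra all_field.
From mathcomp Require Import all_classical all_reals all_analysis.
From mathcomp Require Import ring.

Set Implicit Arguments.
Unset Strict Implicit.
Unset Printing Implicit Defensive.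

Import Order.TTheory GRing.Theory Num.Theory.

Local Open Scope classical_set_scope.
Local Open Scope ring_scope.

(* The Cayley transform w(x) = (x - theta_2) / (x - theta_1), where theta_1 and
   theta_2 are the two fixed points of phi, embeds P^1(Q_p) into the unit
   sphere of Q_p(sqrt Delta) and conjugates phi to multiplication by
   lambda, which has absolute value 1. So phi is an isometry for the
   ultrametric |w(x) - w(y)|, which induces the topology of P^1(Q_p).
   Minimality makes phi transitive on the balls of a given radius that meet B,
   so any two invariant probabilities of B agree on balls and are equal.
   In the coordinate z = h^-1(x) the fixed points are +-theta with
   |theta| = sqrt p; the balls are p-adic balls in z on h(Z_p) and p-adic balls
   in 1/z on the complement, hence mu_bar o h^-1 gives all balls of a given
   radius the same mass. It remains to see that B has positive mass. Recurrence
   gives lambda^m = 1 + t with t small, t != 0 since lambda is not a root of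
   unity, and |lambda^(m p^j) - 1| = |t| p^-j; as the residue field is F_p, an
   orbit of phi is dense in some ball, so that B is open. *)

(** * Ultrametric absolute values *)

Section UltrametricAbs.
Variables (R : realType) (F : fieldType) (v : F -> R).
Hypothesis hv : ultrametric_abs v.

Lemma uabs_ge0 x : 0 <= v x. Proof. by have [] := hv. Qed.

Lemma uabs_eq0 x : (v x == 0) = (x == 0).
Proof. by have [_ h _ _] := hv; apply/eqP/eqP => /h. Qed.

Lemma uabs0 : v 0 = 0. Proof. by apply/eqP; rewrite uabs_eq0. Qed.

Lemma uabs_gt0 x : (0 < v x) = (x != 0).
Proof. by rewrite lt_def uabs_ge0 andbT uabs_eq0. Qed.

Lemma uabsM x y : v (x * y) = v x * v y. Proof. by have [] := hv. Qed.

Lemma uabs1 : v 1 = 1.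
Proof.
have n0 : v 1 != 0 by rewrite uabs_eq0 oner_eq0.
by apply: (mulIf n0); rewrite mul1r -uabsM mulr1.
Qed.

Lemma uabsN x : v (- x) = v x.
Proof.
suff vN1 : v (-1) = 1 by rewrite -mulN1r uabsM vN1 mul1r.
apply/eqP; rewrite -(@eqrXn2 _ 2%N) ?uabs_ge0 ?ler01 //.
by rewrite expr1n expr2 -uabsM mulrNN mulr1 uabs1.
Qed.

Lemma uabsBC x y : v (x - y) = v (y - x).
Proof. by rewrite -opprB uabsN. Qed.

Lemma uabsX x n : v (x ^+ n) = v x ^+ n.
Proof. by elim: n => [|n ih]; rewrite ?expr0 ?uabs1 // !exprS uabsM ih. Qed.

Lemma uabsV x : v x^-1 = (v x)^-1.
Proof.
have [->|x0] := eqVneq x 0; first by rewrite invr0 uabs0 invr0.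
have vx0 : v x != 0 by rewrite uabs_eq0.
by apply: (mulIf vx0); rewrite -uabsM !mulVf // uabs1.
Qed.

Lemma uabs_div x y : v (x / y) = v x / v y.
Proof. by rewrite uabsM uabsV. Qed.

Lemma uabsD_le x y e : v x <= e -> v y <= e -> v (x + y) <= e.
Proof. by have [_ _ _ h] := hv => hx hy; rewrite (le_trans (h _ _))// ge_max hx. Qed.

Lemma uabsD_lt x y e : v x < e -> v y < e -> v (x + y) < e.
Proof. by have [_ _ _ h] := hv => hx hy; rewrite (le_lt_trans (h _ _))// gt_max hx. Qed.

Lemma uabsB_le x y e : v x <= e -> v y <= e -> v (x - y) <= e.
Proof. by move=> hx hy; apply: uabsD_le; rewrite ?uabsN. Qed.

Lemma uabsB_lt x y e : v x < e -> v y < e -> v (x - y) < e.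
Proof. by move=> hx hy; apply: uabsD_lt; rewrite ?uabsN. Qed.

Lemma uabs_trans_le y x z e : v (x - y) <= e -> v (y - z) <= e -> v (x - z) <= e.
Proof. by move=> hx hy; rewrite -(subrK y x) -addrA uabsD_le. Qed.

Lemma uabs_trans_lt y x z e : v (x - y) < e -> v (y - z) < e -> v (x - z) < e.
Proof. by move=> hx hy; rewrite -(subrK y x) -addrA uabsD_lt. Qed.

(** Isosceles principle: if the sum were smaller than [x], then [x = (x + y) - y] would be smaller
    than itself. *)
Lemma uabsD_eq x y : v y < v x -> v (x + y) = v x.
Proof.
move=> yx; apply/eqP; rewrite eq_le uabsD_le ?(ltW yx) //=.
rewrite leNgt; apply/negP => h.
have := uabsB_lt h yx; rewrite addrK ltxx //.
Qed.

Lemma uabsDr_eq x y : v x < v y -> v (x + y) = v y.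
Proof. by rewrite addrC; exact: uabsD_eq. Qed.

Lemma uabs_nat_le1 n : v n%:R <= 1.
Proof.
elim: n => [|n ih]; first by rewrite uabs0 ler01.
by rewrite -natr1 uabsD_le // uabs1.
Qed.

(** First-order binomial expansion: the remainder r_n obeys r_(n+1) = r_n (1 + t) + n t^2, where 1 +
    t and n have absolute value at most 1. *)
Lemma uabs_expD1 t n : v t <= 1 -> v ((1 + t) ^+ n - 1 - n%:R * t) <= v t ^+ 2.
Proof.
move=> t1; elim: n => [|n ih].
  by rewrite expr0 subrr mul0r subr0 uabs0 exprn_ge0 ?uabs_ge0.
have -> : (1 + t) ^+ n.+1 - 1 - n.+1%:R * t =
  ((1 + t) ^+ n - 1 - n%:R * t) * (1 + t) + n%:R * (t ^+ 2).
  by rewrite exprSr -natr1; ring.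
apply: uabsD_le.
  rewrite uabsM (le_trans _ ih)// ler_piMr ?uabs_ge0//.
  by apply: uabsD_le; rewrite ?uabs1.
by rewrite uabsM uabsX ler_piMl ?exprn_ge0 ?uabs_ge0 ?uabs_nat_le1.
Qed.

End UltrametricAbs.

(** * The field of p-adic numbers *)

Section PadicField.
Variables (R : realType) (p : nat) (K : padicFieldType R p).
Hypothesis p_pr : prime p.

Local Notation "`| x |_p" := (padic_abs x) (format "`| x |_p").
Local Notation P := (p%:R : R).

Let hv := @padic_abs_ultrametric R p K.

Lemma natp_gt1 : 1 < P. Proof. by rewrite ltr1n prime_gt1. Qed.
Lemma natp_gt0 : 0 < P. Proof. by rewrite ltr0n prime_gt0. Qed.
Lemma natp_ge0 : 0 <= P. Proof. exact: ltW natp_gt0. Qed.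
Lemma natp_neq0 : P != 0. Proof. by rewrite gt_eqF ?natp_gt0. Qed.

(** A rational closer to [x] than |x| has the absolute value of [x] by the isosceles principle, and
    the values of nonzero rationals are powers of [p]. *)
Lemma padic_abs_value (x : K) : x != 0 -> exists k : int, `|x|_p = P ^ k.
Proof.
move=> x0; have vx : 0 < `|x|_p by rewrite uabs_gt0.
have [q hq] := @padic_rat_dense R p K x _ vx.
have -> : `|x|_p = `|ratr q : K|_p.
  rewrite -[ratr q](subrK x) addrC uabsD_eq //.
  by rewrite uabsBC.
have q0 : q != 0.
  apply: contraTneq hq => ->.
  by rewrite (ratr_int _ 0 : ratr 0 = 0) subr0 ltxx.
rewrite padic_abs_rat /rat_padic_abs (negPf q0).
exists ((logn p `|denq q|)%:Z - (logn p `|numq q|)%:Z).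
by rewrite expfzDr ?natp_neq0// -exprnN.
Qed.

Lemma padic_abs_gap (x y : K) : `|x|_p < `|y|_p -> P * `|x|_p <= `|y|_p.
Proof.
have [->|x0] := eqVneq x 0; first by rewrite (uabs0 hv) mulr0 (uabs_ge0 hv).
have [->|y0] := eqVneq y 0; first by rewrite (uabs0 hv) ltNge (uabs_ge0 hv).
have [k ->] := padic_abs_value x0; have [l ->] := padic_abs_value y0.
rewrite ltr_eXz2l ?natp_gt1// -[X in X * _]expr1z -expfzDr ?natp_neq0//.
by rewrite ler_eXz2l ?natp_gt1// lez1D.
Qed.

Lemma padic_abs_lt1 (x : K) : `|x|_p < 1 -> `|x|_p <= P^-1.
Proof.
rewrite -{1}(uabs1 hv) => /padic_abs_gap; rewrite (uabs1 hv).
by rewrite -(ler_pM2l natp_gt0 _ P^-1) divff ?natp_neq0.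
Qed.

Lemma padic_abs_gt1 (x : K) : 1 < `|x|_p -> P <= `|x|_p.
Proof. by rewrite -{1}(uabs1 hv) => /padic_abs_gap; rewrite (uabs1 hv) mulr1. Qed.

Lemma padic_abs_nat n : (0 < n)%N -> `|n%:R : K|_p = P ^- logn p n.
Proof.
move=> n0; have := @padic_abs_rat R p K n%:R; rewrite ratr_nat => ->.
rewrite /rat_padic_abs pnatr_eq0 gtn_eqF //.
by rewrite -[n%:R]/((n%:Z)%:~R) denq_int numq_int /= logn1 expr0 mul1r.
Qed.

Lemma padic_abs_p : `|p%:R : K|_p = P^-1.
Proof. by rewrite padic_abs_nat ?prime_gt0// logn_prime// eqxx. Qed.

Lemma padic_abs_coprime n : coprime p n -> `|n%:R : K|_p = 1.
Proof.
move=> pn; rewrite padic_abs_nat; last first.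
  by case: n pn => //; rewrite /coprime gcdn0 => /eqP p1; move: p_pr; rewrite p1.
have [/eqP ->|] := boolP (logn p n == 0)%N; first by rewrite expr0 invr1.
by rewrite -lt0n logn_gt0 mem_primes => /and3P[_ _]; rewrite -[(p %| n)%N]negbK -prime_coprime // pn.
Qed.

Lemma small_expV (e : R) : 0 < e -> exists k : nat, P ^- k < e.
Proof.
move=> e0; have [n hn] : exists n : nat, e^-1 < n%:R.
  by exists (Num.truncn e^-1).+1; rewrite truncnS_gt.
exists n; rewrite -[e]invrK ltf_pV2 ?posrE ?exprn_gt0 ?natp_gt0 ?invr_gt0//.
by rewrite (lt_trans hn)// -natrX ltr_nat ltn_expl// prime_gt1.
Qed.

Lemma large_exp (e : R) : exists k : nat, e <= P ^+ k.
Proof.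
have [|e0] := leP e 0; first by exists 0%N; rewrite expr0 (le_trans _ ler01).
have [|k hk] := @small_expV e^-1; first by rewrite invr_gt0.
by exists k; rewrite ltW// -[P ^+ k]invrK -[e]invrK ltf_pV2 ?posrE ?invr_gt0 ?exprn_gt0 ?natp_gt0.
Qed.

Lemma padic_abs_pX k : `|p%:R ^+ k : K|_p = P ^- k.
Proof. by rewrite (uabsX hv) padic_abs_p exprVn. Qed.

Lemma padic_abs_int_le1 (z : int) : `|z%:~R : K|_p <= 1.
Proof.
case: z => n; first exact: (uabs_nat_le1 hv).
by rewrite NegzE mulrNz (uabsN hv) (uabs_nat_le1 hv).
Qed.

(** Density of the naturals in Z_p: a rational N/D near [x] is p-integral, so D is invertible modulo
    p^k, and [i] is the residue of N/D. *)
Lemma padic_int_near_nat (x : K) k : `|x|_p <= 1 ->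
  exists2 i, (i < p ^ k)%N & `|x - i%:R|_p <= P ^- k.
Proof.
move=> x1; have [|q hq] := @padic_rat_dense R p K x (P ^- k).
  by rewrite invr_gt0 exprn_gt0// natp_gt0.
have k1 : P ^- k <= 1 by rewrite invf_le1 ?exprn_gt0 ?natp_gt0// exprn_ege1// ltW// natp_gt1.
have q1 : `|ratr q : K|_p <= 1.
  rewrite -[ratr q](subKr x) (uabsB_le hv)// ltW// (lt_le_trans hq)//.
set D := `|denq q|%N; set N := numq q.
(* If [p] divided the denominator, it would not divide the numerator, and |q| would exceed 1. *)
have cop : coprime p D.
  rewrite prime_coprime//; apply/negP => pD.
  have pN : ~~ (p %| `|N|)%N.
    rewrite -prime_coprime// (coprime_dvdl pD)// coprime_sym.
    exact: coprime_num_den.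
  have q0 : q != 0 by apply: contraNneq pN; rewrite /N => ->.
  move: q1; rewrite padic_abs_rat /rat_padic_abs (negPf q0) -/D -/N.
  rewrite (_ : logn p `|N| = 0%N) ?expr0 ?divr1; last first.
    by apply/eqP; rewrite eqn0Ngt logn_gt0 mem_primes p_pr (negPf pN) !andbF.
  apply/negP; rewrite -ltNge exprn_egt1 ?natp_gt1// -lt0n logn_gt0 mem_primes.
  by rewrite p_pr pD absz_gt0 denq_neq0.
have D0 : (0 < D)%N by rewrite absz_gt0 denq_neq0.
(* Bezout gives u D = 1 + l p^k, so N u represents N/D modulo p^k. *)
have /(coprimeP _ D0)[[u l] /= ul] : coprime D (p ^ k).
  by rewrite coprime_sym coprimeXl.
have pk0 : (0 < p ^ k)%N by rewrite expn_gt0 prime_gt0.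
have {}ul : (u * D = 1 + l * p ^ k)%N.
  by rewrite -ul addnC subnKC// ltnW// -subn_gt0 ul.
set m := (N * u%:Z)%R.
have mE := divz_eq m (p ^ k)%N%:Z.
have m_ge0 : 0 <= (m %% (p ^ k)%N%:Z)%Z by rewrite modz_ge0// -lt0n.
exists `|(m %% (p ^ k)%N%:Z)%Z|%N.
  by rewrite -ltz_nat gez0_abs// ltz_pmod.
set i := `|_|%N; have iE : i%:Z = m - (m %/ (p ^ k)%N%:Z)%Z * (p ^ k)%N%:Z.
  by rewrite /i gez0_abs// {2}mE addrAC subrr add0r.
apply: (uabs_trans_le hv (ltW hq)).
have DK : `|D%:R : K|_p = 1 by rewrite padic_abs_coprime.
have D0K : D%:R != 0 :> K by rewrite -(uabs_eq0 hv) DK oner_eq0.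
have qE : ratr q * D%:R = N%:~R :> K.
  rewrite /ratr -/N.
  have -> : (denq q)%:~R = D%:R :> K.
    by rewrite /D -[in LHS](gez0_abs (ltW (denq_gt0 q))).
  by rewrite divfK.
have -> : ratr q - i%:R = p%:R ^+ k *
    ((m %/ (p ^ k)%N%:Z)%Z * D%:Z - N * l%:Z)%:~R / D%:R :> K.
  apply: (mulIf D0K); rewrite mulrBl qE divfK//.
  have := congr1 (fun z : int => z%:~R : K) iE.
  have := congr1 (fun z : nat => z%:R : K) ul.
  rewrite !(natrM, natrD, natrX, rmorphB, rmorphM, rmorphD) /=.
  rewrite -!pmulrn => eu ei.
  transitivity (N%:~R * (u%:R * D%:R - l%:R * p%:R ^+ k) - i%:R * D%:R : K).
    by rewrite eu addrK mulr1.
  by rewrite ei natrX; ring.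
rewrite (uabs_div hv) DK divr1 (uabsM hv) padic_abs_pX.
rewrite ler_piMr ?padic_abs_int_le1// invr_ge0 exprn_ge0// natp_ge0.
Qed.

Lemma padic_nbhsP (x : K) (A : set K) :
  nbhs x A <-> exists k : nat, [set y | `|y - x|_p <= P ^- k] `<=` A.
Proof.
rewrite nbhs_padicP; split=> [[e e0 eA]|[k kA]].
  have [k ke] := small_expV e0; exists k => y /= yx; apply: eA => /=.
  by rewrite (uabsBC hv) (le_lt_trans yx).
exists (P ^- k); first by rewrite invr_gt0 exprn_gt0// natp_gt0.
by move=> y /= yx; apply: kA; rewrite /= (uabsBC hv) ltW.
Qed.

Lemma padic_cball_open (x : K) k : open [set y : K | `|y - x|_p <= P ^- k].
Proof.
rewrite openE => y /= yx; apply/padic_nbhsP; exists k => z /= zy.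
exact: (uabs_trans_le hv zy).
Qed.

Lemma padic_cball_closed (x : K) (r : R) : closed [set y : K | `|y - x|_p <= r].
Proof.
move=> y cly /=; rewrite leNgt; apply/negP => ry.
have [z0 [/= z0x _]] := cly setT filterT.
have yx0 : 0 < `|y - x|_p by rewrite (le_lt_trans _ ry)// (le_trans _ z0x)// (uabs_ge0 hv).
have [|z [/= zx zy]] := cly [set z | `|y - z|_p < `|y - x|_p].
  by apply/nbhs_padicP; exists `|y - x|_p.
have := uabs_trans_lt hv zy (le_lt_trans zx ry).
by rewrite ltxx.
Qed.

Lemma ultra_bigcup_ord (T : Type) (F : set_system T) (A : nat -> set T) n :
  UltraFilter F -> F [set x | exists2 i, (i < n)%N & A i x] ->
  exists2 i, (i < n)%N & F (A i).
Proof.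
move=> FU; elim: n => [|n ih] FA.
  have /filter_ex[x []] := FA; by [].
have [|Fn] := in_ultra_setVsetC (A n) FU; first by exists n.
have [|i ilt Fi] := ih; last by exists i => //; exact: ltnW.
apply: filterS (filterI FA Fn) => x [[i]].
rewrite ltnS leq_eqVlt => /predU1P[->//|ilt Aix _]; by exists i.
Qed.

(** Total boundedness and completeness: for every [k] an ultrafilter on the ball contains a ball of
    radius p^-k; the centres form a Cauchy sequence, and the filter converges to their limit. *)
Lemma padic_cball_compact (x0 : K) (r : R) : compact [set x : K | `|x - x0|_p <= r].
Proof.
set A := [set _ | _]; rewrite compact_ultra => F FU FA.
have [N rN] := large_exp r.
have pN0 : p%:R ^+ N != 0 :> K.
  by rewrite -(uabs_eq0 hv) padic_abs_pX invr_eq0 expf_neq0// natp_neq0.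
(* Multiplication by p^N moves the ball, recentred at 0, into Z_p, where the p^(N+k) residues modulo
   p^(N+k) provide a finite cover. *)
have center k : exists c : K, F [set x | `|x - c|_p <= P ^- k].
  pose C i : set K := [set x | `|x - (x0 + i%:R / p%:R ^+ N)|_p <= P ^- k].
  have [|i _ Fi] := @ultra_bigcup_ord _ F C (p ^ (N + k)) FU; last by exists (x0 + i%:R / p%:R ^+ N).
  apply: filterS FA => x /= xr.
  have [|i ilt hi] := @padic_int_near_nat ((x - x0) * p%:R ^+ N) (N + k).
    rewrite (uabsM hv) padic_abs_pX ler_pdivrMr ?exprn_gt0 ?natp_gt0// mul1r.
    exact: le_trans rN.
  exists i => //; rewrite /C /=.
  have -> : x - (x0 + i%:R / p%:R ^+ N) = ((x - x0) * p%:R ^+ N - i%:R) / p%:R ^+ N.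
    by rewrite mulrBl mulfK// opprD addrA.
  rewrite (uabs_div hv) padic_abs_pX invrK (le_trans (ler_wpM2r _ hi)) ?exprn_ge0 ?natp_ge0//.
  by rewrite exprD invfM mulrAC mulVf ?mul1r// expf_neq0// natp_neq0.
have [c hc] := choice center.
(* Two members of the filter meet, which bounds the distance of their centres. *)
have cc n m k : (k <= n)%N -> (k <= m)%N -> `|c n - c m|_p <= P ^- k.
  move=> kn km; have [x [/= xn xm]] := filter_ex (filterI (hc n) (hc m)).
  have mono j : (k <= j)%N -> P ^- j <= P ^- k.
    by move=> kj; rewrite lef_pV2 ?posrE ?exprn_gt0 ?natp_gt0// ler_eXn2l// natp_gt1.
  rewrite (uabs_trans_le hv (y := x))// ?(uabsBC hv _ x).
    by rewrite (le_trans xn)// mono.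
  by rewrite (le_trans xm)// mono.
have [|l hl] := @padic_complete R p K c.
  move=> e e0; have [k ke] := small_expV e0; exists k => m n km kn.
  by rewrite (le_lt_trans _ ke)// cc.
have Fl : F --> l.
  move=> U /padic_nbhsP[k kU].
  have [|M hM] := hl (P ^- k); first by rewrite invr_gt0 exprn_gt0// natp_gt0.
  apply: filterS (hc (maxn M k)) => x /= xc; apply: kU => /=.
  apply: (uabs_trans_le hv (y := c (maxn M k))); last first.
    by rewrite ltW// hM// leq_maxl.
  by rewrite (le_trans xc)// lef_pV2 ?posrE ?exprn_gt0 ?natp_gt0// ler_eXn2l ?leq_maxr// natp_gt1.
exists l; split=> //; apply: (padic_cball_closed (x := x0) (r := r)).
move=> U /Fl FU'; exact: filter_ex (filterI FA FU').
Qed.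

End PadicField.

(** * Unique ergodicity of minimal isometries *)

Lemma mnormalizeE d (T : measurableType d) (R : realType)
    (mu : {measure set T -> \bar R}) (P : probability T R) (A : set T) :
  (0 < mu setT)%E -> (mu setT < +oo)%E ->
  mnormalize mu P A = (mu A * (fine (mu setT))^-1%:E)%E.
Proof. by move=> mu0 muy; rewrite /mnormalize (gt_eqF mu0) (lt_eqF muy). Qed.

Section BallSystem.
(** An ultrametric is encoded by its balls: for each [k] the sets [bal k x] partition the space, and
    the partitions refine one another and generate the topology. The sequence [e] is dense. *)
Variables (R : realType) (X : ptopologicalType) (bal : nat -> X -> set X).
Hypothesis bal_refl : forall k x, bal k x x.
Hypothesis bal_eq : forall k x y, bal k x y -> bal k y = bal k x.
Hypothesis bal_monoS : forall k x, bal k.+1 x `<=` bal k x.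
Hypothesis nbhs_bal : forall x (U : set X), nbhs x U <-> exists k, bal k x `<=` U.
Variable e : nat -> X.
Hypothesis bal_dense : forall k x, exists n, bal k x (e n).

Lemma bal_mono j k x : (j <= k)%N -> bal k x `<=` bal j x.
Proof.
move/subnK <-; elim: (k - j)%N => // n ih.
by rewrite addSn; apply: subset_trans ih; exact: bal_monoS.
Qed.

Lemma bal_open k x : open (bal k x).
Proof.
rewrite openE => y xy; apply/nbhs_bal; exists k.
by rewrite (bal_eq xy).
Qed.

Lemma bal_measurable k x : measurable (bal k x : set (borel X)).
Proof. by apply: sub_sigma_algebra; exact: bal_open. Qed.

Lemma bal_disjoint j k x y : (j <= k)%N -> bal j x `&` bal k y !=set0 -> bal k y `<=` bal j x.
Proof.
move=> jk [z [xz yz]]; rewrite -(bal_eq xz) -(bal_eq yz); exact: bal_mono.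
Qed.

Variable k0 : nat.

(** The index starts at [k0] because balls from there on lie in [B] as soon as they meet it, as
    assumed later. The empty set makes the family stable under intersection. *)
Definition small_balls : set (set X) :=
  [set A | A = set0 \/ exists2 k, (k0 <= k)%N & exists x, A = bal k x].

Lemma small_balls_setI : setI_closed small_balls.
Proof.
move=> A C [->|[j kj [x ->]]] [->|[k kk [y ->]]]; rewrite ?(setI0, set0I); try by left.
have [->|/set0P ne] := eqVneq (bal j x `&` bal k y) set0; first by left.
right; have [jk|/ltnW kj'] := leqP j k.
  by exists k => //; exists y; apply/setIidPr; exact: bal_disjoint.
by exists j => //; exists x; apply/setIidPl; apply: bal_disjoint => //; rewrite setIC.
Qed.

Lemma borel_small_balls : @measurable _ (borel X) = <<s small_balls >>.
Proof.
apply/seteqP; split; apply: smallest_sub.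
- exact: smallest_sigma_algebra.
- move=> U oU; pose A (nk : nat * nat) := bal (k0 + nk.2) (e nk.1).
  (* A countable union: the centres run through the dense sequence and the indices start at [k0]. *)
  have -> : U = \bigcup_(nk in [set nk | A nk `<=` U]) A nk.
    apply/seteqP; split=> [x Ux|x [nk /= AU /AU//]].
    have /nbhs_bal[k kU] : nbhs x U by exact: open_nbhs_nbhs.
    have [n en] := bal_dense (k0 + k) x.
    exists (n, k); rewrite /A /= (bal_eq en) //.
    exact: subset_trans (bal_mono (leq_addl _ _)) kU.
  rewrite bigcup_mkcond.
  apply: (@countable_bigcupT_measurable _ (g_sigma_algebraType small_balls)) => // nk.
  case: ifP => _; last exact: measurable0.
  by apply: sub_sigma_algebra; right; exists (k0 + nk.2)%N; [exact: leq_addr|exists (e nk.1)].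
- exact: smallest_sigma_algebra.
- move=> A [->|[k _ [x ->]]]; first exact: measurable0.
  exact: bal_measurable.
Qed.

(** * Probabilities carried by a compact set and equal on balls of equal radius *)

Variable B : set X.
Hypothesis B_compact : compact B.

(** By compactness finitely many disjoint balls cover [B], and they share the mass 1 equally. Their
    number is chosen before [tau], hence is common to all such probabilities. *)
Lemma equal_balls_mass k : exists n : nat, forall tau : probability (borel X) R,
  tau B = 1%E -> measurable (B : set (borel X)) ->
  (forall x y, B x -> B y -> tau (bal k x) = tau (bal k y)) ->
  forall x, B x -> (n%:R%:E * tau (bal k x) = 1)%E.
Proof.
move: B_compact; rewrite compact_cover => /(_ X B (bal k)).
case=> [x _|x Bx|I IB BI]; [exact: bal_open|by exists x => //|].
(* A set of balls, not of centres, so that coinciding balls are counted once. *)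
pose D := [set bal k i | i in [set` I]].
have D_fin : finite_set D by apply: finite_image; exact: finite_fset.
exists #|` fset_set D|%N => tau tB mB tauE x Bx.
have DE : forall A, A \in fset_set D -> exists2 i, B i & A = bal k i.
  move=> C; rewrite in_fset_set// => /set_mem -[j /= jI <-]; exists j => //.
  by have /set_mem := IB j jI.
have mD : forall A : set X, D A -> measurable (A : set (borel X)).
  by move=> _ [i _ <-]; exact: bal_measurable.
have tD : trivIset D id.
  move=> _ _ [i _ <-] [j _ <-] [z [iz jz]].
  by rewrite -(bal_eq iz) -(bal_eq jz).
have cover : tau (\bigcup_(A in D) A) = 1%E.
  have mU : measurable (\bigcup_(A in D) A : set (borel X)).
    apply: fin_bigcup_measurable => //.
  apply/eqP; rewrite eq_le probability_le1//= -tB le_measure ?inE//.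
  by move=> y /BI[i iI iy]; exists (bal k i) => //; exists i.
rewrite -[RHS]cover measure_fin_bigcup//= fsbig_finite//=.
rewrite big_seq (eq_bigr (fun=> tau (bal k x))); last first.
  by move=> A /DE[i Bi ->]; exact: tauE.
rewrite -big_seq big_const_seq count_predT.
have /fineK <- : tau (bal k x) \is a fin_num.
  by apply: fin_num_measure; exact: bal_measurable.
elim: (size _) => [|m ih] /=; first by rewrite mul0e.
by rewrite -ih -!EFinM -EFinD -natr1 mulrDl mul1r addrC.
Qed.

(** Balls that miss [B] have mass 0, those that meet it have mass 1/n with the same n for both
    measures, and the small balls form a generating pi-system. *)
Lemma probability_eq_of_equal_balls (tau sigma : probability (borel X) R) :
  tau B = 1%E -> sigma B = 1%E -> measurable (B : set (borel X)) ->
  (forall k x y, (k0 <= k)%N -> B x -> B y -> tau (bal k x) = tau (bal k y)) ->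
  (forall k x y, (k0 <= k)%N -> B x -> B y -> sigma (bal k x) = sigma (bal k y)) ->
  forall A : set (borel X), measurable A -> tau A = sigma A.
Proof.
move=> tB sB mB tE sE A mA.
have outside (nu : probability (borel X) R) : nu B = 1%E ->
    forall C : set (borel X), measurable C -> C `&` B = set0 -> nu C = 0%E.
  move=> nuB C mC CB; apply/eqP; rewrite eq_le measure_ge0 andbT.
  rewrite (_ : 0%E = nu (~` B)); last first.
    by rewrite probability_setC// nuB subee.
  rewrite le_measure ?inE//; first exact: measurableC.
  by apply/disjoints_subset.
apply: (@measure_unique _ R (borel X) small_balls (fun n => bal k0 (e n))) => //.
- exact: borel_small_balls.
- exact: small_balls_setI.
- by move=> n; right; exists k0 => //; exists (e n).
- rewrite -subTset => x _; have [n xn] := bal_dense k0 x.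
  by exists n => //; rewrite (bal_eq xn).
- move=> _ [->|[k kk [x ->]]]; first by rewrite !measure0.
  have [xB|/set0P[y [xy By]]] := eqVneq (bal k x `&` B) set0.
    transitivity (0%E : \bar R); last symmetry.
      by apply: (outside tau tB) xB; exact: bal_measurable.
    by apply: (outside sigma sB) xB; exact: bal_measurable.
  rewrite -(bal_eq xy); have [n nE] := equal_balls_mass k.
  have tn := nE tau tB mB (fun x y => tE k x y kk) y By.
  have sn := nE sigma sB mB (fun x y => sE k x y kk) y By.
  have tfin : tau (bal k y) \is a fin_num by apply: fin_num_measure; exact: bal_measurable.
  have sfin : sigma (bal k y) \is a fin_num by apply: fin_num_measure; exact: bal_measurable.
  move: tn sn; rewrite -(fineK tfin) -(fineK sfin) -!EFinM => -[tn] [sn].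
  have n0 : n%:R != 0 :> R.
    by apply/eqP => n0; move: tn; rewrite n0 mul0r => /esym/eqP; rewrite oner_eq0.
  rewrite -[LHS](fineK tfin) -[RHS](fineK sfin).
  by congr (_%:E); apply: (mulfI n0); rewrite tn sn.
- move=> k; apply: (le_lt_trans (probability_le1 _ _)); last exact: ltry.
  exact: bal_measurable.
Qed.

Lemma closure_balP (S : set X) y : closure S y <-> forall k, exists2 z, S z & bal k y z.
Proof.
split=> [cl k|cl U /nbhs_bal[k kU]].
  have [|z [Sz yz]] := cl (bal k y); last by exists z.
  by apply/nbhs_bal; exists k.
by have [z Sz yz] := cl k; exists z; split => //; exact: kU.
Qed.

(** * Isometries with a minimal compact set *)

Variable phi : X -> X.
Hypothesis phi_bal : forall k x y, bal k (phi x) (phi y) <-> bal k x y.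
Hypothesis B_neq0 : B !=set0.
Hypothesis phiB : phi @` B `<=` B.
Hypothesis B_minimal :
  forall x, B x -> B = closure [set iter n phi x | n in [set: nat]].

Lemma iter_phiB n x : B x -> B (iter n phi x).
Proof. by move=> Bx; elim: n => // n ih; apply: phiB; exists (iter n phi x). Qed.

Lemma minimal_visits k x y : B x -> B y -> exists n, bal k y (iter n phi x).
Proof.
move=> Bx; rewrite (B_minimal Bx) => /closure_balP/(_ k)[_ [n _ <-] yx].
by exists n.
Qed.

Lemma minimal_closed : closed B.
Proof.
by have [x Bx] := B_neq0; rewrite (B_minimal Bx); exact: closed_closure.
Qed.

Lemma minimal_measurable : measurable (B : set (borel X)).
Proof.
rewrite -[B]setCK; apply: measurableC; apply: sub_sigma_algebra.
exact/closed_openC/minimal_closed.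
Qed.

(* A point whose image is in [B] is approached by the orbit of that image,
   which returns to itself, so it lies in the closed set [B]. *)
Lemma minimal_backward x : B (phi x) -> B x.
Proof.
move=> Bx; apply: minimal_closed; apply/closure_balP => k.
have Bxx : B (phi (phi x)) by apply: phiB; exists (phi x).
have [n hn] := minimal_visits k Bxx Bx.
exists (iter n phi (phi x)); first exact: iter_phiB.
by apply/phi_bal; rewrite -iterS iterSr.
Qed.

Lemma preimage_phi_bal k x : phi @^-1` bal k (phi x) = bal k x.
Proof. by apply/seteqP; split=> y /= /phi_bal. Qed.

Lemma phi_measurable : measurable_fun [set: borel X] (phi : borel X -> borel X).
Proof.
apply: (@measurability _ _ (borel X) (borel X) setT phi (@open X) erefl) => // _ [U oU <-]; rewrite setTI.
apply: sub_sigma_algebra; rewrite /= openE => x Ux; apply/nbhs_bal.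
have /nbhs_bal[k kU] : nbhs (phi x) U by exact: open_nbhs_nbhs.
by exists k; rewrite -preimage_phi_bal => y; exact: kU.
Qed.

(** The ball around [phi z] pulls back to the ball around [z], so the mass is constant along an
    orbit, and the orbit of [x] enters the ball of [y]. *)
Lemma invariant_equal_balls (tau : probability (borel X) R) :
  tau B = 1%E ->
  (forall A : set (borel X), measurable A -> A `<=` B ->
    tau (B `&` phi @^-1` A) = tau A) ->
  forall k x y, B x -> B y -> tau (bal k x) = tau (bal k y).
Proof.
move=> tB tinv k x y Bx By; have mB := minimal_measurable.
(* Invariance is only given for subsets of [B]; as [tau] is carried by [B], balls may be cut down to
   [B]. *)
have restr (C : set (borel X)) : measurable C -> tau (B `&` C) = tau C.
  move=> mC; apply/eqP; rewrite eq_le le_measure ?inE//=; last first.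
  - by apply: measurableI.
  rewrite -[leRHS]adde0 -(_ : tau (~` B) = 0%E); last first.
    by rewrite probability_setC// tB subee.
  apply: (le_trans (y := tau ((B `&` C) `|` ~` B))).
    rewrite le_measure ?inE//; last 1 first.
    - by move=> z Cz; have [Bz|nBz] := pselect (B z); [left|right].
    by apply: measurableU; [exact: measurableI|exact: measurableC].
  by apply: measureU2; [exact: measurableI|exact: measurableC].
have step z : B z -> tau (bal k (phi z)) = tau (bal k z).
  move=> Bz; rewrite -restr; last exact: bal_measurable.
  rewrite -tinv; last by move=> ? [].
    rewrite -[in RHS]restr; last exact: bal_measurable.
    rewrite preimage_setI preimage_phi_bal setIA.
    congr (tau (_ `&` _)); apply/setIidPl => v Bv.
    by apply: phiB; exists v.
  by apply: measurableI => //; exact: bal_measurable.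
have [n yx] := minimal_visits k Bx By.
rewrite -(bal_eq yx) => {yx}; elim: n => // n ih.
by rewrite iterS step//; exact: iter_phiB.
Qed.

(** * Existence, uniqueness and formula for the invariant probability *)

Variable mu : {measure set (borel X) -> \bar R}.
Hypothesis mu_fin : (mu B < +oo)%E.
Hypothesis mu_bal : forall k x y, mu (bal k x) = mu (bal k y).
Hypothesis mu_bal_gt0 : forall k x, (0 < mu (bal k x))%E.
Hypothesis bal_sub : forall x, B x -> bal k0 x `<=` B.

(** The candidate is [mu] restricted to [B] and normalised. Any invariant probability has equal
    masses on balls of equal index that meet [B], hence is the candidate; the image of the candidate
    under [phi] has this property too, which proves invariance. *)
Theorem minimal_uniquely_ergodic : exists sigma : probability (borel X) R,
  [/\ sigma B = 1%E /\
      (forall A : set (borel X), measurable A -> A `<=` B ->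
        sigma (B `&` phi @^-1` A) = sigma A),
      forall tau : probability (borel X) R,
        tau B = 1%E /\
        (forall A : set (borel X), measurable A -> A `<=` B ->
          tau (B `&` phi @^-1` A) = tau A) ->
        forall A : set (borel X), measurable A -> A `<=` B -> tau A = sigma A
    & forall A : set (borel X), measurable A -> A `<=` B ->
        sigma A = (mu A / mu B)%E].
Proof.
have [x0 Bx0] := B_neq0; have mB := minimal_measurable.
have muB0 : (0 < mu B)%E.
  apply: lt_le_trans (mu_bal_gt0 k0 x0) _; rewrite le_measure ?inE//.
    exact: bal_measurable.
  exact: bal_sub.
have muBfin : mu B \is a fin_num by rewrite ge0_fin_numE.
(* The Dirac mass is the fallback of [mnormalize] for total mass 0 or infinity; here the total mass
   is positive and finite. *)
pose sigma : probability (borel X) R := mnormalize (mrestr mu mB) (dirac (x0 : borel X)).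
have sE A : sigma A = (mu (A `&` B) / mu B)%E.
  have mf0 : (fine (mu B) == 0) = false by apply: gt_eqF; rewrite fine_gt0// muB0.
  have rT : mrestr mu mB setT = mu B by rewrite /mrestr setTI.
  rewrite [LHS]mnormalizeE; [|by rewrite [ltRHS]rT|by rewrite [ltLHS]rT].
  rewrite -[in (mu B)^-1%E](fineK muBfin) inver mf0.
  by congr (_ * (fine _)^-1%:E)%E.
have sAE A : A `<=` B -> sigma A = (mu A / mu B)%E.
  by move=> AB; rewrite sE; congr (mu _ / _)%E; exact/setIidPl.
have sB : sigma B = 1%E by rewrite sAE// divee// gt_eqF.
have s_bal k x y : (k0 <= k)%N -> B x -> B y -> sigma (bal k x) = sigma (bal k y).
  move=> kk Bx By; rewrite !sAE ?(mu_bal k x y)//.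
    exact: subset_trans (bal_mono kk) (bal_sub By).
  exact: subset_trans (bal_mono kk) (bal_sub Bx).
have unique (tau : probability (borel X) R) : tau B = 1%E ->
    (forall A : set (borel X), measurable A -> A `<=` B ->
      tau (B `&` phi @^-1` A) = tau A) ->
    forall A : set (borel X), measurable A -> tau A = sigma A.
  move=> tB tinv; apply: probability_eq_of_equal_balls => //.
  by move=> k x y _; exact: invariant_equal_balls.
exists sigma; split; last 2 first.
- by move=> tau [tB tinv] A mA _; exact: unique.
- by move=> A mA AB; exact: sAE.
split=> // A mA AB.
pose sphi : probability (borel X) R :=
  distribution sigma (mfun_Sub (mem_set phi_measurable)).
have preB : phi @^-1` B `<=` B by exact: minimal_backward.
have Bpre : B `<=` phi @^-1` B by move=> x Bx; apply: phiB; exists x.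
have -> : B `&` phi @^-1` A = phi @^-1` A.
  by apply/setIidPr => x /= Ax; apply: preB; exact: AB.
transitivity (sphi A); first by [].
apply: probability_eq_of_equal_balls => //.
- transitivity (sigma (phi @^-1` B)); first by [].
  by rewrite (_ : phi @^-1` B = B)//; exact/seteqP.
have sphiE k y : B y -> exists2 z, B z & sphi (bal k y) = sigma (bal k z).
  (* Starting the orbit at [phi x0] makes the visiting point an image under [phi], so that the
     preimage of its ball is again a ball. *)
  move=> By; have Bphi : B (phi x0) by apply: phiB; exists x0.
  have [n yn] := minimal_visits k Bphi By.
  exists (iter n phi x0); first exact: iter_phiB.
  transitivity (sigma (phi @^-1` bal k y)); first by [].
  by rewrite -(bal_eq yn) -iterSr iterS preimage_phi_bal.
move=> k x y kk Bx By.
have [u Bu ->] := sphiE k x Bx; have [v Bv ->] := sphiE k y By.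
exact: s_bal.
Qed.

End BallSystem.

(** * The Cayley transform of the projective line *)

Section CayleyTransform.
Variables (R : realType) (p : nat) (K : padicFieldType R p).
Variables (L : fieldType) (iota : {rmorphism K -> L}) (absL : L -> R).
Variables (a b c d eta : K) (s : L).

Local Notation "`| x |_p" := (padic_abs x) (format "`| x |_p").
Local Notation P := (p%:R : R).

Hypothesis p_pr : prime p.
Hypothesis p_ge3 : (3 <= p)%N.
Hypothesis hL : ultrametric_abs absL.
Hypothesis abs_iota : forall x, absL (iota x) = `|x|_p.
Hypothesis s2 : s ^+ 2 = iota ((d - a) ^+ 2 + 4 * b * c).
Hypothesis sNK : forall x, s != iota x.

Let hv := @padic_abs_ultrametric R p K.

Let phi := mobius a b c d.

(** The multiplier lambda, a quotient of the two eigenvalues of the matrix of [phi]. *)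
Definition cayley_mult : L := (iota (a + d) + s) / (iota (a + d) - s).

(* The numerator and the denominator are multiplied by [2 c]. *)
Definition cayley (x : proj_line K) : L :=
  if x is Some x then
    (iota (2 * c * x + d - a) + s) / (iota (2 * c * x + d - a) - s)
  else 1.

Lemma iotaBs_neq0 x : iota x - s != 0.
Proof. by rewrite subr_eq0 eq_sym sNK. Qed.

Lemma iotaDs_neq0 x : iota x + s != 0.
Proof. by rewrite addrC -(opprK (iota x)) subr_eq0 -rmorphN sNK. Qed.

Lemma abs2 : `|2%:R : K|_p = 1.
Proof.
by apply: padic_abs_coprime => //; rewrite coprime_sym prime_coprime// dvdn_prime2// neq_ltn p_ge3.
Qed.

Lemma two_neq0 : 2 != 0 :> K.
Proof. by rewrite -(uabs_eq0 hv) abs2 oner_eq0. Qed.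

(** For c = 0 the discriminant is the square of d - a, which would put its root [s] in Q_p. *)
Lemma c_neq0 : c != 0.
Proof.
apply/eqP => c0; have : (s - iota (d - a)) * (s + iota (d - a)) = 0.
  by rewrite -subr_sqr s2 c0 mulr0 addr0 rmorphXn subrr.
move/eqP; rewrite mulf_eq0 => /orP[|].
  by rewrite subr_eq0 (negPf (sNK _)).
by rewrite -[iota _]opprK subr_eq0 -rmorphN (negPf (sNK _)).
Qed.

Lemma cayley_mobius x : cayley (phi x) = cayley_mult * cayley x.
Proof.
have c0 := c_neq0; have n2 := two_neq0.
case: x => [x|] /=; last first.
  by rewrite (negPf c0) /= mulr1 /cayley_mult; congr ((iota _ + _) / (iota _ - _)); field.
rewrite /cayley_mult.
(* At the pole of [phi] the image is infinity, of transform 1, and [cayley x] is the inverse of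
   lambda. *)
have [cxd|cxd] := eqVneq (c * x + d) 0.
  have -> : 2 * c * x + d - a = - (a + d).
    by rewrite -mulrA (_ : c * x = - d); [ring|apply/eqP; rewrite -addr_eq0 cxd].
  have h1 := iotaBs_neq0 (a + d); have h2 := iotaDs_neq0 (a + d).
  rewrite rmorphN /=; move: (iota _) h1 h2 => A h1 h2; field.
  by rewrite h1 -opprD oppr_eq0 h2.
set X := 2 * c * x + d - a; set y := (a * x + b) / (c * x + d).
(* One factorisation serves the numerator, with e = s, and the denominator, with e = -s. *)
have key (e : L) : e ^+ 2 = iota ((d - a) ^+ 2 + 4 * b * c) ->
    iota (2 * c * y + d - a) + e = (iota (a + d) + e) * (iota X + e) / iota (2 * (c * x + d)).
  move=> e2.
  have n0 : iota (2 * (c * x + d)) != 0 by rewrite fmorph_eq0 mulf_neq0.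
  apply: (mulIf n0); rewrite divfK//.
  have -> : (iota (a + d) + e) * (iota X + e) = iota (a + d) * iota X + e ^+ 2 + e * iota (a + d + X).
    by rewrite (rmorphD _ (a + d) X); ring.
  rewrite e2 mulrDl -!rmorphM -rmorphD; congr (iota _ + e * iota _).
    by rewrite /y /X; field.
  by rewrite /X; ring.
rewrite /= key // (key (- s)); last by rewrite sqrrN.
have h1 := iotaBs_neq0 (a + d); have h2 := iotaBs_neq0 X.
have n0 : iota (2 * (c * x + d)) != 0 by rewrite fmorph_eq0 mulf_neq0.
move: (iota (2 * _)) (iota (a + d)) (iota X) h1 h2 n0 => C A Y h1 h2 n0.
by field; rewrite h1 h2 n0.
Qed.

Lemma cayley_iter n x : cayley (iter n phi x) = cayley_mult ^+ n * cayley x.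
Proof.
by elim: n => [|n ih]; rewrite ?expr0 ?mul1r// iterS cayley_mobius ih exprS mulrA.
Qed.

(** * The two halves of the line in the coordinate z *)

Hypothesis eta_neq0 : eta != 0.

(** The fixed points of [phi] are +-[theta] in the coordinate z. Their absolute value [T], the
    square root of p, lies strictly between the consecutive values 1 and p of Q_p. *)
Variable theta : L.
Hypothesis sE : s = theta * iota (2 * c * eta).
Local Notation T := (absL theta).
Hypothesis theta_sqr : T ^+ 2 = P.

Let v := (a - d) / (2 * c).

(** Two charts: [inner] is used on Z_p and [outer], the same chart after inversion, on p Z_p. The
    images of these sets are the two halves of the line. *)
Definition inner (z : K) : proj_line K := affine_map eta v (affine z).
Definition outer (u : K) : proj_line K := affine_map eta v (inversion (affine u)).

Lemma scale_neq0 : iota (2 * c * eta) != 0.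
Proof. by rewrite fmorph_eq0 !mulf_neq0// ?two_neq0 ?c_neq0. Qed.

Lemma thetaNK x : theta != iota x.
Proof.
apply: contra_neq (sNK (x * (2 * c * eta))) => tx.
by rewrite sE tx -rmorphM.
Qed.

Lemma abs_theta_ge0 : 0 <= T. Proof. exact: uabs_ge0. Qed.

Lemma abs_theta_gt1 : 1 < T.
Proof. by rewrite -(@ltr_pXn2r _ 2) ?nnegrE ?ler01 ?abs_theta_ge0// expr1n theta_sqr natp_gt1. Qed.

Lemma abs_theta_ltp : T < P.
Proof.
rewrite -(@ltr_pXn2r _ 2) ?nnegrE ?abs_theta_ge0 ?natp_ge0//.
by rewrite theta_sqr -[ltLHS]expr1 ltr_eXn2l// natp_gt1.
Qed.

Lemma abs_theta_gt0 : 0 < T. Proof. exact: lt_trans ltr01 abs_theta_gt1. Qed.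

Lemma iotaBtheta_neq0 z : iota z - theta != 0.
Proof. by rewrite subr_eq0 eq_sym thetaNK. Qed.

Lemma outer_den_neq0 u : 1 - iota u * theta != 0.
Proof.
have [->|u0] := eqVneq u 0; first by rewrite rmorph0 mul0r subr0 oner_eq0.
have iu0 : iota u != 0 by rewrite fmorph_eq0.
rewrite -(mulfV iu0) -mulrBr mulf_neq0// -fmorphV; exact: iotaBtheta_neq0.
Qed.

Lemma cayley_inner z : cayley (inner z) = (iota z + theta) / (iota z - theta).
Proof.
have c0 := c_neq0; have n2 := two_neq0.
rewrite /=; have -> : 2 * c * (eta * z + v) + d - a = z * (2 * c * eta).
  by rewrite /v; field; rewrite n2 c0.
rewrite sE rmorphM -mulrDl -mulrBl.
have h1 := scale_neq0; have h2 := iotaBtheta_neq0 z.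
move: (iota (2 * _ * _)) h1 => C h1.
by field; rewrite h1 h2.
Qed.

Lemma cayley_outer u : cayley (outer u) = (1 + iota u * theta) / (1 - iota u * theta).
Proof.
rewrite /outer /inversion /affine; have [->|u0] := eqVneq u 0.
  by rewrite /= rmorph0 mul0r addr0 subr0 divr1.
rewrite -/(inner u^-1) cayley_inner fmorphV.
have iu0 : iota u != 0 by rewrite fmorph_eq0.
have h2 := outer_den_neq0 u; have := iotaBtheta_neq0 u^-1; rewrite fmorphV => h1.
by field; rewrite iu0 h2.
Qed.

(** No |z| equals [T]: it is at most 1 or at least p, so the larger of the two terms dominates. *)
Lemma abs_inner_den_ge z : T <= absL (iota z - theta).
Proof.
have [z1|z1] := leP `|z|_p 1.
  by rewrite (uabsBC hL) uabsD_eq// (uabsN hL) abs_iota (le_lt_trans z1)// abs_theta_gt1.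
have zT : T < `|z|_p by apply: lt_le_trans (padic_abs_gt1 p_pr z1); exact: abs_theta_ltp.
by rewrite (uabsD_eq hL) ?(uabsN hL) ?abs_iota// ltW.
Qed.

Lemma abs_inner_den z : `|z|_p <= 1 -> absL (iota z - theta) = T.
Proof.
by move=> z1; rewrite (uabsBC hL) uabsD_eq// (uabsN hL) abs_iota (le_lt_trans z1)// abs_theta_gt1.
Qed.

Lemma abs_iota_theta u : `|u|_p < 1 -> absL (iota u * theta) < 1.
Proof.
move=> /(padic_abs_lt1 p_pr) u1; rewrite (uabsM hL) abs_iota.
rewrite (le_lt_trans (ler_wpM2r abs_theta_ge0 u1))// mulrC ltr_pdivrMr ?natp_gt0// mul1r.
exact: abs_theta_ltp.
Qed.

Lemma abs_outer_den u : `|u|_p < 1 -> absL (1 - iota u * theta) = 1.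
Proof.
by move=> u1; rewrite uabsD_eq// ?(uabsN hL) (uabs1 hL)// abs_iota_theta.
Qed.

Lemma proj_line_cover x :
  (exists2 z, `|z|_p <= 1 & x = inner z) \/ (exists2 u, `|u|_p < 1 & x = outer u).
Proof.
case: x => [x|]; last first.
  right; exists 0; first by rewrite (uabs0 hv) ltr01.
  by rewrite /outer /inversion /= eqxx.
have xE : Some x = inner ((x - v) / eta).
  by rewrite /inner /affine /affine_map (mulrC eta) divfK// subrK.
have [z1|z1] := leP `|(x - v) / eta|_p 1; first by left; exists ((x - v) / eta).
right; exists ((x - v) / eta)^-1; first by rewrite (uabsV hv) invf_lt1// (lt_trans ltr01).
rewrite /outer /inversion /= invr_eq0 ifF; last first.
  apply/negbTE; apply: contraTneq z1 => ->; by rewrite (uabs0 hv) -leNgt ler01.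
by rewrite invrK /affine /= (mulrC eta) divfK// subrK.
Qed.

(** The same summand dominates numerator and denominator: [theta] on the inner half, 1 on the outer
    half. *)
Lemma abs_cayley x : absL (cayley x) = 1.
Proof.
have [[z z1 ->]|[u u1 ->]] := proj_line_cover x.
  rewrite cayley_inner (uabs_div hL) abs_inner_den//.
  rewrite (uabsDr_eq hL) ?divff// ?gt_eqF ?abs_theta_gt0//.
  by rewrite abs_iota (le_lt_trans z1)// abs_theta_gt1.
rewrite cayley_outer (uabs_div hL) abs_outer_den// (uabsD_eq hL) ?(uabs1 hL) ?divr1//.
exact: abs_iota_theta.
Qed.

Lemma abs_iota2 : absL 2 = 1.
Proof. by rewrite -(rmorph_nat iota) abs_iota abs2. Qed.

Lemma cayleyB_inner z w : cayley (inner z) - cayley (inner w) =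
  2 * theta * iota (w - z) / ((iota z - theta) * (iota w - theta)).
Proof.
have h1 := iotaBtheta_neq0 z; have h2 := iotaBtheta_neq0 w.
by rewrite !cayley_inner rmorphB; field; rewrite h1 h2.
Qed.

Lemma cayleyB_outer u w : cayley (outer u) - cayley (outer w) =
  2 * theta * iota (u - w) / ((1 - iota u * theta) * (1 - iota w * theta)).
Proof.
have h1 := outer_den_neq0 u; have h2 := outer_den_neq0 w.
by rewrite !cayley_outer rmorphB; field; rewrite h1 h2.
Qed.

Lemma cayley_dist_inner z w : `|z|_p <= 1 -> `|w|_p <= 1 ->
  absL (cayley (inner z) - cayley (inner w)) = `|z - w|_p / T.
Proof.
move=> z1 w1; rewrite cayleyB_inner (uabs_div hL) !(uabsM hL) !abs_inner_den//.
rewrite abs_iota2 mul1r abs_iota (uabsBC hv).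
by have := abs_theta_gt0 => T0; field; rewrite gt_eqF.
Qed.

(** Holds on all of Q_p, which makes the chart continuous beyond Z_p. *)
Lemma cayley_dist_inner_le z w :
  absL (cayley (inner z) - cayley (inner w)) <= `|z - w|_p / T.
Proof.
rewrite cayleyB_inner (uabs_div hL) !(uabsM hL) abs_iota2 mul1r abs_iota (uabsBC hv).
have T0 := abs_theta_gt0; have hz := abs_inner_den_ge z; have hw := abs_inner_den_ge w.
have z0 := lt_le_trans T0 hz; have w0 := lt_le_trans T0 hw.
rewrite ler_pdivrMr ?mulr_gt0// mulrC -mulrA ler_wpM2l ?(uabs_ge0 hv)//.
by rewrite -ler_pdivrMl ?invr_gt0// invrK ler_pM// ltW.
Qed.

Lemma cayley_dist_outer u w : `|u|_p < 1 -> `|w|_p < 1 ->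
  absL (cayley (outer u) - cayley (outer w)) = T * `|u - w|_p.
Proof.
move=> u1 w1; rewrite cayleyB_outer (uabs_div hL) !(uabsM hL) !abs_outer_den//.
by rewrite abs_iota2 mul1r abs_iota mulr1 divr1.
Qed.

Lemma cayley_dist_inner_outer z u : `|z|_p <= 1 -> `|u|_p < 1 ->
  absL (cayley (inner z) - cayley (outer u)) = 1.
Proof.
move=> z1 u1.
have -> : cayley (inner z) - cayley (outer u) =
    2 * theta * (1 - iota (u * z)) / ((iota z - theta) * (1 - iota u * theta)).
  have h1 := iotaBtheta_neq0 z; have h2 := outer_den_neq0 u.
  by rewrite cayley_inner cayley_outer rmorphM; field; rewrite h1 h2.
rewrite (uabs_div hL) !(uabsM hL) abs_inner_den// abs_outer_den// abs_iota2 mul1r mulr1.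
rewrite (uabsD_eq hL) ?(uabs1 hL) ?mulr1 ?divff ?gt_eqF ?abs_theta_gt0//.
rewrite (uabsN hL) abs_iota (uabsM hv) (le_lt_trans _ u1)//.
by rewrite ler_piMr// (uabs_ge0 hv).
Qed.

(** * Balls of the Cayley metric and the topology of the projective line *)

Definition cayley_ball (k : nat) (x : proj_line K) : set (proj_line K) :=
  [set y | absL (cayley x - cayley y) < P ^- k].
Local Notation bal := cayley_ball.

Lemma expV_gt0 k : 0 < P ^- k.
Proof. by rewrite invr_gt0 exprn_gt0// natp_gt0. Qed.

Lemma expVS k : P ^- k.+1 = P ^- k / P.
Proof. by rewrite exprS invfM mulrC. Qed.

Lemma expV_le j k : (j <= k)%N -> P ^- k <= P ^- j.
Proof.
by move=> jk; rewrite lef_pV2 ?posrE ?exprn_gt0 ?natp_gt0// ler_eXn2l// natp_gt1.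
Qed.

Lemma expV_le1 k : P ^- k <= 1.
Proof. by have := expV_le (leq0n k); rewrite expr0 invr1. Qed.

(** As 1 < [T] < p, no value of Q_p lies strictly between p^-k and [T] p^-k. *)
Lemma lt_theta_expV (x : K) k : (`|x|_p < T * P ^- k) = (`|x|_p <= P ^- k).
Proof.
apply/idP/idP => [|xk]; last first.
  by rewrite (le_lt_trans xk)// -[ltLHS]mul1r ltr_pM2r ?expV_gt0// abs_theta_gt1.
apply: contraTT; rewrite -ltNge -leNgt -(padic_abs_pX K p_pr) => /(padic_abs_gap p_pr).
by apply: le_trans; rewrite (padic_abs_pX K p_pr) ler_pM2r ?expV_gt0// ltW// abs_theta_ltp.
Qed.

Lemma abs_theta_inv : T^-1 = T / P.
Proof. by rewrite -theta_sqr expr2 invfM mulrA divff ?mul1r// gt_eqF// abs_theta_gt0. Qed.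

Lemma cayley_ball_inner k z y : `|z|_p <= 1 ->
  bal k (inner z) y <-> exists2 w, `|z - w|_p <= P ^- k & y = inner w.
Proof.
move=> z1; have k1 := expV_le1 k.
have ball_dist w : (`|z - w|_p / T < P ^- k) = (`|z - w|_p <= P ^- k).
  by rewrite ltr_pdivrMr ?abs_theta_gt0// mulrC lt_theta_expV.
split=> [|[w zw ->]]; last first.
  rewrite /cayley_ball /= cayley_dist_inner ?ball_dist//.
  by rewrite -[w](subKr z) (uabsB_le hv)// (le_trans zw).
have [[w w1 ->]|[u u1 ->]] := proj_line_cover y; rewrite /cayley_ball /=.
  by rewrite cayley_dist_inner// ball_dist; exists w.
(* Points of different halves are at distance exactly 1, which the strict inequality excludes even
   for k = 0. *)
by rewrite cayley_dist_inner_outer// ltNge k1.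
Qed.

(** The index moves to [k.+1] because [outer] scales distances by [T] and [inner] by 1/[T], a
    discrepancy of [T]^2 = p. *)
Lemma cayley_ball_outer k u y : `|u|_p < 1 ->
  bal k (outer u) y <-> exists2 w, `|u - w|_p <= P ^- k.+1 & y = outer w.
Proof.
move=> u1; have k1 := expV_le1 k.
have ball_dist w : (T * `|u - w|_p < P ^- k) = (`|u - w|_p <= P ^- k.+1).
  rewrite -lt_theta_expV -ltr_pdivlMl ?abs_theta_gt0// abs_theta_inv expVS.
  by congr (_ < _); ring.
split=> [|[w uw ->]]; last first.
  rewrite /cayley_ball /= cayley_dist_outer ?ball_dist//.
  rewrite -[w](subKr u) (uabsB_lt hv)// (le_lt_trans uw)// expVS ltr_pdivrMr ?natp_gt0// mul1r.
  by rewrite (le_lt_trans k1)// natp_gt1.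
have [[w w1 ->]|[w w1 ->]] := proj_line_cover y; rewrite /cayley_ball /=.
  by rewrite (uabsBC hL) cayley_dist_inner_outer// ltNge k1.
by rewrite cayley_dist_outer// ball_dist; exists w.
Qed.

Lemma cayley_ball_refl k x : bal k x x.
Proof. by rewrite /cayley_ball /= subrr (uabs0 hL) expV_gt0. Qed.

Lemma cayley_ball_eq k x y : bal k x y -> bal k y = bal k x.
Proof.
rewrite /cayley_ball /= => xy; apply/seteqP; split=> z /= yz.
  exact: (uabs_trans_lt hL xy).
by apply: (uabs_trans_lt hL _ yz); rewrite (uabsBC hL).
Qed.

Lemma cayley_ball_monoS k x : bal k.+1 x `<=` bal k x.
Proof. by move=> y /=; rewrite /cayley_ball /= => /lt_le_trans; apply; exact: expV_le. Qed.

Lemma nbhs_infty (U : set (proj_line K)) :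
  nbhs (infty K) U <-> exists k, bal k (infty K) `<=` U.
Proof.
have inftyE : infty K = outer 0 by rewrite /outer /inversion /= eqxx.
have o1 : `|0 : K|_p < 1 by rewrite (uabs0 hv) ltr01.
have e0 : 0 < `|eta|_p by rewrite (uabs_gt0 hv).
split=> [[C [Cc _] CU]|[k kU]].
  (* Compact sets are bounded: finitely many of the balls |x - v| < n cover, and the sum of these n
     is a bound. *)
  have [r Cr] : exists r : R, forall x, C x -> `|x - v|_p <= r.
    move: Cc; rewrite compact_cover.
    case/(_ nat setT (fun n => [set x | `|x - v|_p < n%:R])) => [n _|x _|D _ CD].
    - rewrite openE => x /= xn; apply/nbhs_padicP; exists n%:R.
        by rewrite (le_lt_trans _ xn)// (uabs_ge0 hv).
      by move=> y /= xy; apply: (uabs_trans_lt hv (y := x)) => //; rewrite (uabsBC hv).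
    - by exists (Num.truncn `|x - v|_p).+1 => //=; rewrite truncnS_gt.
    - exists (\sum_(i <- D) i)%N%:R => x /CD[i /= iD /ltW xi].
      by rewrite (le_trans xi)// ler_nat (big_rem i)//= leq_addr.
  have [k rk] := large_exp p_pr (r / `|eta|_p); exists k => y.
  rewrite inftyE => /(cayley_ball_outer _ _ o1)[w wk ->]; move: wk; rewrite sub0r (uabsN hv) => wk.
  apply: CU; rewrite /outer /inversion /affine /=.
  have [w0|w0] := eqVneq w 0; first by right.
  left; exists (eta * w^-1 + v) => //= /Cr.
  rewrite addrK (uabs_div hv) leNgt => /negP; apply.
  rewrite -ltr_pdivrMl// mulrC (le_lt_trans rk)//.
  have wgt : 0 < `|w|_p by rewrite (uabs_gt0 hv).
  rewrite -[P ^+ k]invrK ltf_pV2 ?posrE ?expV_gt0// (le_lt_trans wk)// expVS.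
  by rewrite ltr_pdivrMr ?natp_gt0// -[ltLHS]mulr1 ltr_pM2l ?expV_gt0// natp_gt1.
(* Outside this compact ball u = eta / (x - v) has |u| < p^-k, hence |u| <= p^-(k+1) by
   discreteness. *)
exists [set x | `|x - v|_p <= `|eta|_p * P ^+ k].
  by split; [exact: padic_cball_compact|exact: padic_cball_closed].
move=> y [[x /= /negP]|/= ->]; last by apply: kU; exact: cayley_ball_refl.
rewrite -ltNge => xv <-; apply: kU; rewrite inftyE; apply/(cayley_ball_outer _ _ o1).
have xv0 : x - v != 0.
  rewrite -(uabs_gt0 hv) (lt_trans _ xv)// mulr_gt0// exprn_gt0// natp_gt0//.
exists (eta / (x - v)); last first.
  rewrite /outer /inversion /= mulf_eq0 invr_eq0 (negPf eta_neq0) (negPf xv0) /=.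
  by rewrite invf_div (mulrC eta) divfK// subrK.
rewrite sub0r (uabsN hv) expVS ler_pdivlMr ?natp_gt0// mulrC -(padic_abs_pX K p_pr).
apply: (padic_abs_gap p_pr); rewrite (padic_abs_pX K p_pr) (uabs_div hv).
rewrite ltr_pdivrMr ?(uabs_gt0 hv)// -ltr_pdivrMl ?expV_gt0// invrK mulrC //.
Qed.

Lemma nbhs_affine (x : K) (U : set (proj_line K)) :
  nbhs (affine x) U <-> exists k, bal k (affine x) `<=` U.
Proof.
have e0 : 0 < `|eta|_p by rewrite (uabs_gt0 hv).
split=> [|[k kU]].
  move=> /(padic_nbhsP p_pr)[j jU].
  (* At a finite point it suffices that Cayley balls of index k + i lie in p-adic balls of radius r
     p^-i, with [k] and [r] depending on the point. *)
  suff [k [r r0 hr]] : exists k, exists2 r : R, 0 < r & forall i y, bal (k + i) (affine x) y ->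
      exists2 y0 : K, y = affine y0 & `|y0 - x|_p <= r * P ^- i.
    have [|i ir] := small_expV p_pr (e := P ^- j / r); first by rewrite divr_gt0 ?expV_gt0.
    exists (k + i)%N => y /hr[y0 -> y0x]; apply: jU => /=.
    by rewrite (le_trans y0x)// -ler_pdivlMl// mulrC ltW.
  have [[z z1 xE]|[u u1 xE]] := proj_line_cover (affine x).
    exists 0%N, `|eta|_p => // i y; rewrite xE => /(cayley_ball_inner _ _ z1)[w zw ->].
    exists (eta * w + v) => //; move: xE => -[->].
    rewrite opprD addrACA subrr addr0 -mulrBr (uabsM hv) ler_pM2l//.
    by rewrite (uabsBC hv).
  have u0 : u != 0.
    by apply/eqP => u0; move: xE; rewrite /outer /inversion u0 /= eqxx.
  have up : 0 < `|u|_p by rewrite (uabs_gt0 hv).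
  (* Closer to [u] than |u| one has |w| = |u|, so inversion scales the distance to [u] by |u|^-2. *)
  have [k ku] := small_expV p_pr up.
  exists k, (`|eta|_p / `|u|_p ^+ 2); first by rewrite divr_gt0// exprn_gt0.
  move=> i y; rewrite xE => /(cayley_ball_outer _ _ u1)[w uw ->].
  have wu : `|w|_p = `|u|_p.
    rewrite -[w](subKr u) (uabsD_eq hv)// (uabsN hv) (le_lt_trans uw)//.
    by rewrite (le_lt_trans _ ku)// expV_le// (leq_trans (leq_addr i k)).
  have w0 : w != 0 by rewrite -(uabs_gt0 hv) wu.
  exists (eta / w + v); first by rewrite /outer /inversion /= (negPf w0).
  move: xE; rewrite /outer /inversion /= (negPf u0) => -[->].
  have -> : eta / w + v - (eta / u + v) = eta * (u - w) / (u * w).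
    by field; rewrite u0 w0.
  rewrite (uabs_div hv) !(uabsM hv) wu -expr2 mulrAC ler_pM2l ?divr_gt0 ?exprn_gt0//.
  by rewrite (le_trans uw)// expV_le// (leq_trans (leq_addl k i)).
suff [r r0 hr] : exists2 r : R, 0 < r & forall y : K, `|x - y|_p < r -> bal k (affine x) (affine y).
  by apply/nbhs_padicP; exists r => // y /= /hr /kU.
exists (`|eta|_p * P ^- k) => [|y xy]; first by rewrite mulr_gt0 ?expV_gt0.
have toinner w : affine w = inner ((w - v) / eta).
  by rewrite /inner /affine /= (mulrC eta) divfK// subrK.
rewrite /cayley_ball /mkset !toinner (le_lt_trans (cayley_dist_inner_le _ _))//.
rewrite ltr_pdivrMr ?abs_theta_gt0// (mulrC _ T) lt_theta_expV -mulrBl opprB addrA subrK.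
by rewrite (uabs_div hv) ler_pdivrMr// (mulrC _ `|eta|_p) ltW.
Qed.

Lemma nbhs_cayley_ball x (U : set (proj_line K)) :
  nbhs x U <-> exists k, bal k x `<=` U.
Proof. by case: x => [x|]; [exact: nbhs_affine|exact: nbhs_infty]. Qed.

(** The default 0 fills the indices that encode no rational. *)
Definition rational_points (n : nat) : proj_line K := affine (ratr (odflt 0 (unpickle n))).

Lemma rational_points_dense k x : exists n, bal k x (rational_points n).
Proof.
suff fin y : exists n, bal k (affine y) (rational_points n).
  case: x => [y|]; first exact: fin.
  have inftyE : infty K = outer 0 by rewrite /outer /inversion /= eqxx.
  have pk0 : p%:R ^+ k.+1 != 0 :> K.
    by rewrite -(uabs_gt0 hv) (padic_abs_pX K p_pr) expV_gt0.
  have outerE : outer (p%:R ^+ k.+1) = affine (eta / p%:R ^+ k.+1 + v).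
    by rewrite /outer /inversion /= (negPf pk0).
  (* Infinity is replaced by a finite point of the same ball. *)
  have /cayley_ball_eq <- : bal k (infty K) (outer (p%:R ^+ k.+1)); last first.
    by rewrite outerE.
  rewrite inftyE; apply/cayley_ball_outer; first by rewrite (uabs0 hv) ltr01.
  by exists (p%:R ^+ k.+1) => //; rewrite sub0r (uabsN hv) (padic_abs_pX K p_pr).
have /nbhs_affine : exists k0, bal k0 (affine y) `<=` bal k (affine y) by exists k.
move=> /nbhs_padicP[r r0 hr]; have [q hq] := @padic_rat_dense R p K y r r0.
by exists (pickle q); rewrite /rational_points pickleK /=; exact: hr.
Qed.

(** Infinity has transform 1, so lambda is the transform of its image and lies on the unit
    sphere. *)
Lemma cayley_mult_abs : absL cayley_mult = 1.
Proof.
have := abs_cayley (phi (infty K)); rewrite cayley_mobius (uabsM hL) abs_cayley mulr1 //.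
Qed.

Lemma cayley_ball_mobius k x y : bal k (phi x) (phi y) <-> bal k x y.
Proof.
by rewrite /cayley_ball /= !cayley_mobius -mulrBr (uabsM hL) cayley_mult_abs mul1r.
Qed.

(** * Distances within one half *)

Lemma cayley_half x y : absL (cayley y - cayley x) < 1 ->
  (forall z, `|z|_p <= 1 -> x = inner z -> exists2 w, `|w|_p <= 1 & y = inner w) /\
  (forall u, `|u|_p < 1 -> x = outer u -> exists2 w, `|w|_p < 1 & y = outer w).
Proof.
move=> yx; split=> [z z1|u u1] xE.
  have [//|[w w1 yE]] := proj_line_cover y.
  by move: yx; rewrite xE yE (uabsBC hL) cayley_dist_inner_outer// ltxx.
have [[w w1 yE]|//] := proj_line_cover y.
by move: yx; rewrite xE yE cayley_dist_inner_outer// ltxx.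
Qed.

(** Within a half, distances are values of Q_p times a fixed constant, so they inherit the gap of
    factor p. *)
Lemma cayley_gap x y z : absL (cayley y - cayley x) < absL (cayley z - cayley x) ->
  absL (cayley z - cayley x) < 1 ->
  P * absL (cayley y - cayley x) <= absL (cayley z - cayley x).
Proof.
move=> yz z1; have [hy1 hy2] := cayley_half (lt_trans yz z1).
have [hz1 hz2] := cayley_half z1.
have [[t t1 xE]|[t t1 xE]] := proj_line_cover x.
  have [m m1 yE] := hy1 t t1 xE; have [n n1 zE] := hz1 t t1 xE.
  move: yz; rewrite xE yE zE !cayley_dist_inner//.
  rewrite ltr_pM2r ?invr_gt0 ?abs_theta_gt0// => /(padic_abs_gap p_pr).
  by rewrite mulrA ler_pM2r ?invr_gt0 ?abs_theta_gt0.
have [m m1 yE] := hy2 t t1 xE; have [n n1 zE] := hz2 t t1 xE.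
move: yz; rewrite xE yE zE !cayley_dist_outer//.
rewrite ltr_pM2l ?abs_theta_gt0// => /(padic_abs_gap p_pr).
by rewrite mulrCA ler_pM2l ?abs_theta_gt0.
Qed.

(* The residue field of [K] has [p] elements, and up to a unit congruent to [1]
   ratios of differences of [cayley] on either half are in [K]. *)
Lemma cayley_ratio x y z : absL (cayley y - cayley x) <= absL (cayley z - cayley x) ->
  absL (cayley z - cayley x) < 1 -> cayley z != cayley x ->
  exists i : nat, absL (cayley y - cayley x - i%:R * (cayley z - cayley x)) <
    absL (cayley z - cayley x).
Proof.
move=> yz z1 zx; have zx0 : cayley z - cayley x != 0 by rewrite subr_eq0.
have pos : 0 < absL (cayley z - cayley x) by rewrite (uabs_gt0 hL).
have near (k : K) e : absL e < 1 -> `|k|_p <= 1 ->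
    cayley y - cayley x = (iota k * (1 + e)) * (cayley z - cayley x) ->
    exists i : nat, absL (cayley y - cayley x - i%:R * (cayley z - cayley x)) <
    absL (cayley z - cayley x).
  move=> e1 k1 eq; have [i _ ki] := padic_int_near_nat p_pr 1 k1.
  exists i; rewrite eq -mulrBl (uabsM hL) -[ltRHS]mul1r ltr_pM2r//.
  rewrite mulrDr mulr1 addrAC -(rmorph_nat iota) -rmorphB (uabsD_lt hL) ?abs_iota//.
    by rewrite (le_lt_trans ki)// expr1 invf_lt1 ?natp_gt0// natp_gt1.
  by rewrite (uabsM hL) abs_iota (le_lt_trans _ e1)// ler_piMl// (uabs_ge0 hL).
have [hy1 hy2] := cayley_half (le_lt_trans yz z1).
have [hz1 hz2] := cayley_half z1.
have [[t t1 xE]|[t t1 xE]] := proj_line_cover x.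
  have [m m1 yE] := hy1 t t1 xE; have [n n1 zE] := hz1 t t1 xE.
  have nt : n - t != 0.
    by apply: contra_neq zx0 => /eqP; rewrite subr_eq0 => /eqP nt; rewrite zE xE nt subrr.
  (* The differences have quotient (m - t)/(n - t) times (n - theta)/(m - theta), and the second
     factor is 1 + e. The outer half uses (1 - n theta)/(1 - m theta) likewise. *)
  apply: (near ((m - t) / (n - t)) ((iota (n - m)) / (iota m - theta))).
  - rewrite (uabs_div hL) abs_iota abs_inner_den// ltr_pdivrMr ?abs_theta_gt0// mul1r.
    by rewrite (le_lt_trans _ abs_theta_gt1)// (uabsB_le hv).
  - move: yz; rewrite xE yE zE !cayley_dist_inner// ler_pM2r ?invr_gt0 ?abs_theta_gt0//.
    by rewrite (uabs_div hv) ler_pdivrMr ?(uabs_gt0 hv)// mul1r.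
  rewrite xE yE zE !cayleyB_inner !(rmorphB, fmorph_div) /=.
  have h1 := iotaBtheta_neq0 t; have h2 := iotaBtheta_neq0 n; have h3 := iotaBtheta_neq0 m.
  have nt' : iota n - iota t != 0 by rewrite -rmorphB fmorph_eq0.
  by field; rewrite h1 h2 h3 nt'.
have [m m1 yE] := hy2 t t1 xE; have [n n1 zE] := hz2 t t1 xE.
have nt : n - t != 0.
  by apply: contra_neq zx0 => /eqP; rewrite subr_eq0 => /eqP nt; rewrite zE xE nt subrr.
apply: (near ((m - t) / (n - t)) (iota (m - n) * theta / (1 - iota m * theta))).
- by rewrite (uabs_div hL) abs_outer_den// divr1 abs_iota_theta// (uabsB_lt hv).
- move: yz; rewrite xE yE zE !cayley_dist_outer// ler_pM2l ?abs_theta_gt0//.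
  by rewrite (uabs_div hv) ler_pdivrMr ?(uabs_gt0 hv)// mul1r.
rewrite xE yE zE !cayleyB_outer !(rmorphB, fmorph_div) /=.
have h1 := outer_den_neq0 t; have h2 := outer_den_neq0 n; have h3 := outer_den_neq0 m.
have nt' : iota n - iota t != 0 by rewrite -rmorphB fmorph_eq0.
by field; rewrite h1 h2 h3 nt'.
Qed.

(** * Powers of lambda and density of orbits *)

Lemma abs_p : absL p%:R = P^-1.
Proof. by rewrite -(rmorph_nat iota) abs_iota padic_abs_p. Qed.

(** The linear term p t dominates the binomial remainder, which is at most |t|^2 < |t|/p. *)
Lemma abs_expp_sub1 t : t != 0 -> absL t < P^-1 -> absL ((1 + t) ^+ p - 1) = absL t / P.
Proof.
move=> t0 tp; have t1 : absL t < 1 by rewrite (lt_trans tp)// invf_lt1 ?natp_gt0// natp_gt1.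
have pt : absL (p%:R * t) = absL t / P by rewrite (uabsM hL) abs_p mulrC.
rewrite -pt -[in LHS](subrK (p%:R * t) (_ - 1)) (uabsDr_eq hL)//.
rewrite (le_lt_trans (uabs_expD1 hL _ (ltW t1)))// pt expr2 ltr_pM2l//.
by rewrite (uabs_gt0 hL).
Qed.

Lemma abs_exppX_sub1 l : l != 1 -> absL (l - 1) < P^-1 ->
  forall j, l ^+ (p ^ j) != 1 /\ absL (l ^+ (p ^ j) - 1) = absL (l - 1) * P ^- j.
Proof.
move=> l1 lp; elim=> [|j [n1 ih]].
  by rewrite expn0 expr1 expr0 invr1 mulr1.
have lt : absL (l ^+ (p ^ j) - 1) < P^-1.
  by rewrite ih (le_lt_trans _ lp)// ler_piMr ?(uabs_ge0 hL)// expV_le1.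
have l0 : l ^+ (p ^ j) - 1 != 0 by rewrite subr_eq0.
have e : absL (l ^+ (p ^ j.+1) - 1) = absL (l - 1) * P ^- j.+1.
  have := abs_expp_sub1 l0 lt; rewrite (addrC 1) subrK expnSr exprM => ->.
  by rewrite ih expVS mulrA.
split=> //; rewrite -subr_eq0 -(uabs_gt0 hL) e mulr_gt0 ?expV_gt0//.
by rewrite (uabs_gt0 hL) subr_eq0.
Qed.

(** Successive approximation of [y]: at stage j the iterate of order m p^j moves every point by
    exactly r = |t| p^-j, and a suitable multiple [i] of this move brings the orbit within r/p of
    [y]. *)
Lemma orbit_dense_ball m x y : let t := cayley_mult ^+ m - 1 in
  t != 0 -> absL t < P^-1 -> absL (cayley y - cayley x) <= absL t ->
  forall k, exists n, bal k y (iter n phi x).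
Proof.
move=> t t0 tp yx k; have l1 : cayley_mult ^+ m != 1 by rewrite -subr_eq0.
have tpos : 0 < absL t by rewrite (uabs_gt0 hL).
have t1 : absL t < 1 by rewrite (lt_trans tp)// invf_lt1 ?natp_gt0// natp_gt1.
suff [n hn] : exists n, absL (cayley y - cayley (iter n phi x)) <= absL t * P ^- k.
  exists n; rewrite /cayley_ball /= (le_lt_trans hn)//.
  by rewrite -[ltRHS]mul1r ltr_pM2r ?expV_gt0.
elim: k => [|j [n ih]]; first by exists 0%N; rewrite expr0 invr1 mulr1.
have [lj1 ljE] := abs_exppX_sub1 l1 tp j.
set l := (cayley_mult ^+ m) ^+ (p ^ j) in lj1 ljE.
set r := absL t * P ^- j in ih *.
have r1 : r < 1 by rewrite (le_lt_trans _ t1)// ler_piMr ?expV_le1// ltW.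
have r0 : 0 < r by rewrite mulr_gt0// expV_gt0.
have step i w : cayley (iter (m * p ^ j * i) phi w) = l ^+ i * cayley w.
  by rewrite cayley_iter !exprM.
have stepE w : absL (cayley (iter (m * p ^ j * 1) phi w) - cayley w) = r.
  by rewrite step expr1 -[X in _ - X]mul1r -mulrBl (uabsM hL) abs_cayley mulr1 ljE.
set x' := iter n phi x in ih.
have [|||i hi] := @cayley_ratio x' y (iter (m * p ^ j * 1) phi x'); rewrite ?stepE//.
  by rewrite -subr_eq0 -(uabs_gt0 hL) stepE.
set x2 := iter (m * p ^ j * i) phi x'.
(* [i] steps act like [i] times one step, since l^i - 1 differs from i (l - 1) by at most r^2 <
   r. *)
have close : absL (cayley y - cayley x2) < r.
  have -> : cayley y - cayley x2 =
      (cayley y - cayley x' - i%:R * (cayley (iter (m * p ^ j * 1) phi x') - cayley x'))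
      - ((1 + (l - 1)) ^+ i - 1 - i%:R * (l - 1)) * cayley x'.
    by rewrite /x2 !step expr1 (addrC 1) subrK; ring.
  rewrite (uabsB_lt hL)//; first by rewrite (lt_le_trans hi)// stepE.
  rewrite (uabsM hL) abs_cayley mulr1 (le_lt_trans (uabs_expD1 hL _ _))// ljE -/r ?ltW//.
  by rewrite expr2 -[ltRHS]mulr1 ltr_pM2l.
(* The next possible distance below r is r/p, which turns the strict bound into the bound for j +
   1. *)
exists (m * p ^ j * i + n)%N; rewrite iterD -/x' -/x2.
have := @cayley_gap x2 y (iter (m * p ^ j * 1) phi x2); rewrite stepE => /(_ close r1).
by move=> h; rewrite expVS mulrA -/r ler_pdivlMr ?natp_gt0// mulrC.
Qed.

(** * Minimal sets are open *)

Hypothesis mult_not_root_of_unity : forall n, (0 < n)%N -> cayley_mult ^+ n != 1.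

Variable B : set (proj_line K).
Hypothesis B_minimal : minimal_subsystem phi B.

(** [t] depends only on lambda and a return time, so the orbit of every [y] in [B] is dense in a
    ball of one common radius around [y], and its closure is [B]. *)
Lemma minimal_contains_balls : exists k0, forall x, B x -> bal k0 x `<=` B.
Proof.
have [[x Bx] _ phiB Bmin] := B_minimal.
have visits k y z : B y -> B z -> exists n, bal k z (iter n phi y).
  move=> By; rewrite (Bmin y By) => clz.
  have [|_ [[n _ <-] hn]] := clz (bal k z); last by exists n.
  by apply/nbhs_cayley_ball; exists k.
have Bphi : B (phi x) by apply: phiB; exists x.
(* Index 1 yields |t| < 1/p; starting at [phi x] makes the exponent m + 1 positive. *)
have [m hm] := visits 1%N _ _ Bphi Bx.
pose t := cayley_mult ^+ m.+1 - 1.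
have t0 : t != 0 by rewrite subr_eq0 mult_not_root_of_unity.
have tp : absL t < P^-1.
  move: hm; rewrite -iterSr /cayley_ball /= -/(phi _) -iterS cayley_iter expr1.
  rewrite -[X in X - _]mul1r -mulrBl (uabsM hL) abs_cayley mulr1.
  by rewrite (uabsBC hL).
have tpos : 0 < absL t by rewrite (uabs_gt0 hL).
have [k0 hk0] := small_expV p_pr tpos.
exists k0 => y By z yz; rewrite (Bmin y By) => U /nbhs_cayley_ball[k kU].
have zy : absL (cayley z - cayley y) <= absL t by rewrite (uabsBC hL) ltW// (lt_trans yz).
have [n hn] := @orbit_dense_ball m.+1 y z t0 tp zy k.
by exists (iter n phi y); split; [exists n|exact: kU].
Qed.

(** * Haar measure of p-adic balls *)

Variable mu0 : probability (borel K) R.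
Hypothesis mu0_haar : haar_probability mu0.

Local Notation cball z k := [set w : K | `|z - w|_p <= P ^- k].

Lemma cball_measurable z k : measurable (cball z k : set (borel K)).
Proof.
apply: sub_sigma_algebra; rewrite [X in open X](_ : _ = [set w | `|w - z|_p <= P ^- k]).
  exact: padic_cball_open.
by apply/seteqP; split=> w /=; rewrite (uabsBC hv).
Qed.

Lemma haar_cball_translate z k : `|z|_p <= 1 -> mu0 (cball z k) = mu0 (cball 0 k).
Proof.
move=> z1; have [_ haar] := mu0_haar.
rewrite -[RHS](haar z) //; last 2 first.
- exact: cball_measurable.
- by move=> w /=; rewrite sub0r (uabsN hv) => /le_trans; apply; exact: expV_le1.
congr (mu0 _); apply/seteqP; split=> w /= => [zw|[x]].
  exists (w - z); last by rewrite addrC subrK.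
  by rewrite sub0r opprB.
by rewrite sub0r => x1 <-; rewrite opprD addrA subrr sub0r.
Qed.

(** The ball is the disjoint union of the [p] translates of the next smaller ball by i p^k, i <
    p. *)
Lemma haar_cballS k : mu0 (cball 0 k) = (P%:E * mu0 (cball 0 k.+1))%E.
Proof.
have pkE : `|p%:R ^+ k : K|_p = P ^- k by rewrite padic_abs_pX.
have pk0 : p%:R ^+ k != 0 :> K by rewrite -(uabs_gt0 hv) pkE expV_gt0.
have -> : cball 0 k = \bigcup_(i in `I_p) cball (i%:R * p%:R ^+ k) k.+1.
  apply/seteqP; split=> [w /=|w [i /= _ iw]]; last first.
    rewrite sub0r (uabsN hv) -[w](subKr (i%:R * p%:R ^+ k)) (uabsB_le hv)//.
      by rewrite (uabsM hv) pkE ler_piMl ?(uabs_nat_le1 hv)// ltW ?expV_gt0.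
    by rewrite (le_trans iw)// expV_le.
  rewrite sub0r (uabsN hv) => wk.
  have [|i ilt hi] := @padic_int_near_nat _ _ _ p_pr (w / p%:R ^+ k) 1.
    by rewrite (uabs_div hv) pkE ler_pdivrMr ?expV_gt0// mul1r.
  exists i; first by rewrite /= -[p]expn1.
  rewrite /= (uabsBC hv) -[w in w - _](divfK pk0) -mulrBl (uabsM hv) pkE expVS mulrC.
  by rewrite ler_pM2l ?expV_gt0// (le_trans hi)// expr1.
rewrite measure_fin_bigcup//=; last 2 first.
(* If two translates met, |i - j| <= 1/p would follow, but distinct i, j < p differ by an integer
   prime to p. *)
- move=> i j /= ip jp [w [/= iw jw]]; apply: contrapT => /eqP ij.
  have := uabs_trans_le hv iw (_ : `|w - j%:R * p%:R ^+ k|_p <= P ^- k.+1).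
  rewrite (uabsBC hv w) => /(_ jw); rewrite -mulrBl (uabsM hv) pkE expVS mulrC.
  rewrite ler_pM2l ?expV_gt0// leNgt => /negP; apply.
  wlog ji : i j ip jp ij {iw jw} / (j < i)%N => [hw|].
    have [/hw|ij'|/eqP] := ltngtP j i; [by apply| |by rewrite eq_sym (negPf ij)].
    by rewrite (uabsBC hv); apply: hw => //; rewrite eq_sym.
  rewrite -natrB ?(ltnW ji)// padic_abs_coprime//.
    by rewrite invf_lt1 ?natp_gt0// natp_gt1.
  rewrite prime_coprime// gtnNdvd ?subn_gt0//.
  by rewrite (leq_ltn_trans _ ip)// leq_subr.
- by move=> i _; exact: cball_measurable.
rewrite -fsbig_ord (eq_bigr (fun=> mu0 (cball 0 k.+1))); last first.
  move=> i _; apply: haar_cball_translate.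
  by rewrite (uabsM hv) pkE mulr_ile1 ?(uabs_ge0 hv) ?(uabs_nat_le1 hv) ?expV_le1// ltW// expV_gt0.
have /fineK <- : mu0 (cball 0 k.+1) \is a fin_num.
  by apply: fin_num_measure; exact: cball_measurable.
by rewrite sumEFin sumr_const card_ord -EFinM mulr_natl.
Qed.

Lemma haar_cball z k : `|z|_p <= 1 -> mu0 (cball z k) = (P ^- k)%:E.
Proof.
move=> z1; rewrite haar_cball_translate// => {z z1}.
elim: k => [|k ih].
  have [haar1 _] := mu0_haar; rewrite expr0 invr1 -haar1; congr (mu0 _).
  by apply/seteqP; split=> w /=; rewrite /padic_integers /= sub0r (uabsN hv).
have fin : mu0 (cball 0 k.+1) \is a fin_num.
  by apply: fin_num_measure; exact: cball_measurable.
move: ih; rewrite haar_cballS -(fineK fin) -EFinM => -[ih].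
rewrite -(fineK fin); congr (_%:E).
by apply: (mulfI (natp_neq0 R p_pr)); rewrite ih [RHS]mulrC expVS divfK ?natp_neq0.
Qed.

(** * Measurability of the charts *)

Lemma cayley_dist_outer_le u w :
  absL (cayley (outer u) - cayley (outer w)) <= T * `|u - w|_p.
Proof.
(* For |x| >= 1 the term x theta dominates, so the denominators are at least 1 on all of Q_p. *)
have den x : 1 <= absL (1 - iota x * theta).
  have [x1|x1] := ltP `|x|_p 1; first by rewrite abs_outer_den.
  have xt : 1 < absL (iota x * theta).
    rewrite (uabsM hL) abs_iota (lt_le_trans abs_theta_gt1)// ler_peMl// ltW//; exact: abs_theta_gt0.
  by rewrite (uabsBC hL) (uabsD_eq hL) ?(uabsN hL) ?(uabs1 hL)// ltW.
rewrite cayleyB_outer (uabs_div hL) !(uabsM hL) abs_iota2 mul1r abs_iota.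
have d1 : 1 <= absL (1 - iota u * theta) * absL (1 - iota w * theta).
  by rewrite (le_trans (den u))// ler_peMr// (le_trans ler01).
by rewrite ler_pdivrMr ?(lt_le_trans ltr01)// ler_peMr// mulr_ge0 ?(uabs_ge0 hv) ?abs_theta_ge0.
Qed.

Lemma lipschitz_measurable (f : K -> proj_line K) (r : R) : 0 < r ->
  (forall x y, absL (cayley (f x) - cayley (f y)) <= r * `|x - y|_p) ->
  measurable_fun [set: borel K] (f : borel K -> borel (proj_line K)).
Proof.
move=> r0 hf.
apply: (@measurability _ _ (borel K) (borel (proj_line K)) setT f (@open (proj_line K)) erefl).
move=> _ [U oU <-]; rewrite setTI; apply: sub_sigma_algebra => /=; rewrite openE => x Ux.
have /nbhs_cayley_ball[k kU] : nbhs (f x) U by exact: open_nbhs_nbhs.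
apply/nbhs_padicP; exists (P ^- k / r); first by rewrite divr_gt0 ?expV_gt0.
move=> y /= xy; apply: kU; rewrite /cayley_ball /= (le_lt_trans (hf x y))//.
by rewrite -ltr_pdivlMl// mulrC.
Qed.

Lemma inner_measurable : measurable_fun [set: borel K] (inner : borel K -> borel (proj_line K)).
Proof.
apply: (@lipschitz_measurable _ T^-1) => [|x y]; first by rewrite invr_gt0 abs_theta_gt0.
by rewrite mulrC cayley_dist_inner_le.
Qed.

Lemma outer_measurable : measurable_fun [set: borel K] (outer : borel K -> borel (proj_line K)).
Proof. exact: (lipschitz_measurable abs_theta_gt0 cayley_dist_outer_le). Qed.

Lemma inner_inj : injective inner.
Proof. by move=> z w [/addIr/(mulfI eta_neq0)]. Qed.

Lemma outer_inj : injective outer.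
Proof.
move=> u w; rewrite /outer /inversion /affine.
case: (eqVneq u 0) => [->|_]; case: (eqVneq w 0) => [->|_] //=.
by move=> [/addIr/(mulfI eta_neq0)/invr_inj].
Qed.

Lemma inner_preimage_ball z k : `|z|_p <= 1 -> inner @^-1` bal k (inner z) = cball z k.
Proof.
move=> z1; apply/seteqP; split=> w /=.
  by move/(cayley_ball_inner _ _ z1) => [w' zw' /inner_inj ->].
by move=> zw; apply/(cayley_ball_inner _ _ z1); exists w.
Qed.

Lemma outer_preimage_ball u k : `|u|_p < 1 -> outer @^-1` bal k (outer u) = cball u k.+1.
Proof.
move=> u1; apply/seteqP; split=> w /=.
  by move/(cayley_ball_outer _ _ u1) => [w' uw' /outer_inj ->].
by move=> uw; apply/(cayley_ball_outer _ _ u1); exists w.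
Qed.

Let abs0_le1 : `|0 : K|_p <= 1. Proof. by rewrite (uabs0 hv) ler01. Qed.
Let abs0_lt1 : `|0 : K|_p < 1. Proof. by rewrite (uabs0 hv) ltr01. Qed.

Lemma cayley_ball_measurable k x : measurable (bal k x : set (borel (proj_line K))).
Proof.
by apply: sub_sigma_algebra; apply: bal_open; [exact: cayley_ball_eq|exact: nbhs_cayley_ball].
Qed.

(** * The measure with equal masses on balls of equal radius *)

Let half_nneg : 0 <= 2^-1 :> R. Proof. by rewrite invr_ge0. Qed.
Let halfP_nneg : 0 <= P / 2. Proof. by rewrite divr_ge0. Qed.

(** The image of [mu_bar] under h, built as a bundled measure: images of [mu0] under the two charts,
    each restricted to its half, which is a ball of index 0, and weighted. *)
Definition rotation_measure : {measure set (borel (proj_line K)) -> \bar R} :=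
  measure_add
    (mscale (NngNum half_nneg)
      (mrestr (distribution mu0 (mfun_Sub (mem_set inner_measurable)))
        (cayley_ball_measurable 0 (inner 0))))
    (mscale (NngNum halfP_nneg)
      (mrestr (distribution mu0 (mfun_Sub (mem_set outer_measurable)))
        (cayley_ball_measurable 0 (outer 0)))).

Lemma rotation_measureE A : rotation_measure A =
  ((2^-1)%:E * mu0 (inner @^-1` (A `&` bal 0 (inner 0%R))) +
   (P / 2)%:E * mu0 (outer @^-1` (A `&` bal 0 (outer 0%R))))%E.
Proof. exact: measure_addE. Qed.

Lemma mu_bar_rotation A : mu_bar mu0 (affine_map eta v @^-1` A) = rotation_measure A.
Proof.
rewrite rotation_measureE !preimage_setI inner_preimage_ball// outer_preimage_ball//.
rewrite /mu_bar; congr (_ * mu0 _ + _ * mu0 _)%E; apply/seteqP; split=> z /=.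
- move=> [[w w1 [<-]]] Az; split; first exact: Az.
  by rewrite sub0r (uabsN hv) expr0 invr1.
- rewrite sub0r (uabsN hv) expr0 invr1 => -[Az z1]; split; last exact: Az.
  by exists z.
(* If 1/z is not in Z_p then |z| < 1, hence |z| <= 1/p; z = 0 corresponds to infinity. *)
- move=> [nz Az]; split; first exact: Az.
  rewrite sub0r (uabsN hv) expr1; apply: (padic_abs_lt1 p_pr).
  rewrite ltNge; apply/negP => z1; apply: nz; rewrite /inversion ifF; last first.
    by apply: contraTF z1 => /eqP ->; rewrite (uabs0 hv) -ltNge ltr01.
  by exists z^-1 => //; rewrite /padic_integers /= (uabsV hv) invf_le1// (lt_le_trans ltr01).
- rewrite sub0r (uabsN hv) expr1 => -[Az z1]; split; last exact: Az.
  rewrite /inversion; have [_ [w _ //]|z0] := eqVneq z 0.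
  move=> [w w1 [wz]]; move: w1; rewrite /padic_integers /= wz (uabsV hv).
  rewrite invf_le1 ?(uabs_gt0 hv)// => /le_trans/(_ z1).
  by rewrite leNgt invf_lt1 ?natp_gt0// natp_gt1.
Qed.

(** The weight p/2 on the outer half compensates the index shift there: (p/2) p^-(k+1) = p^-k /
    2. *)
Lemma rotation_measure_ball k x : rotation_measure (bal k x) = (P ^- k / 2)%:E.
Proof.
have sub y : bal k y `<=` bal 0 y by apply: bal_mono => //; exact: cayley_ball_monoS.
have [[z z1 ->]|[u u1 ->]] := proj_line_cover x.
- have in0 : bal 0 (inner z) = bal 0 (inner 0).
    apply: cayley_ball_eq; apply/cayley_ball_inner => //; exists z => //.
    by rewrite sub0r (uabsN hv) expr0 invr1.
  have out0 : bal k (inner z) `&` bal 0 (outer 0) = set0.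
    rewrite -subset0 => y [/sub yz yo].
    have := cayley_ball_eq yz; rewrite (cayley_ball_eq yo) => e.
    have : bal 0 (inner z) (outer 0) by rewrite -e; exact: cayley_ball_refl.
    by rewrite /cayley_ball /= cayley_dist_inner_outer// expr0 invr1 ltxx.
  rewrite rotation_measureE out0 preimage_set0 measure0 mule0 adde0.
  rewrite (_ : bal k (inner z) `&` _ = bal k (inner z)); last first.
    by apply/setIidPl; rewrite -in0.
  by rewrite inner_preimage_ball// haar_cball// -EFinM mulrC.
- have in0 : bal 0 (outer u) = bal 0 (outer 0).
    apply: cayley_ball_eq; apply/cayley_ball_outer => //; exists u => //.
    by rewrite sub0r (uabsN hv) expr1; exact: (padic_abs_lt1 p_pr).
  have out0 : bal k (outer u) `&` bal 0 (inner 0) = set0.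
    rewrite -subset0 => y [/sub yz yo].
    have := cayley_ball_eq yz; rewrite (cayley_ball_eq yo) => e.
    have : bal 0 (inner 0) (outer u) by rewrite e; exact: cayley_ball_refl.
    by rewrite /cayley_ball /= cayley_dist_inner_outer// expr0 invr1 ltxx.
  rewrite rotation_measureE out0 preimage_set0 measure0 mule0 add0e.
  rewrite (_ : bal k (outer u) `&` _ = bal k (outer u)); last first.
    by apply/setIidPl; rewrite -in0.
  rewrite outer_preimage_ball// haar_cball ?ltW// -EFinM expVS; congr (_%:E).
  by rewrite mulrC mulrA divfK// natp_neq0.
Qed.

(** * Unique ergodicity of the Moebius map *)

Lemma mobius_uniquely_ergodic : exists sigma : probability (borel (proj_line K)) R,
  [/\ invariant_probability phi B sigma,
      forall tau : probability (borel (proj_line K)) R,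
        invariant_probability phi B tau ->
        forall A : set (borel (proj_line K)), measurable A -> A `<=` B ->
          tau A = sigma A
    & forall A : set (borel (proj_line K)), measurable A -> A `<=` B ->
        sigma A = (mu_bar mu0 (affine_map eta v @^-1` A) /
                   mu_bar mu0 (affine_map eta v @^-1` B))%E].
Proof.
have [B0 Bc phiB Bmin] := B_minimal; have [k0 hk0] := minimal_contains_balls.
have mB : measurable (B : set (borel (proj_line K))) by exact: (minimal_measurable B0 Bmin).
have mu0_lty (C : set (borel K)) : measurable C -> (mu0 C < +oo)%E.
  by move=> mC; rewrite (le_lt_trans (probability_le1 _ mC))// ltry.
have fin : (rotation_measure B < +oo)%E.
  rewrite rotation_measureE lte_add_pinfty// lte_mul_pinfty//; apply: mu0_lty.
    by rewrite -[X in measurable X]setTI; apply: inner_measurable => //; apply: measurableI => //; exact: cayley_ball_measurable.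
  by rewrite -[X in measurable X]setTI; apply: outer_measurable => //; apply: measurableI => //; exact: cayley_ball_measurable.
have [|||sigma [sinv suniq sE']] := @minimal_uniquely_ergodic R (proj_line K) bal
  cayley_ball_refl cayley_ball_eq cayley_ball_monoS nbhs_cayley_ball
  rational_points rational_points_dense k0 B Bc phi cayley_ball_mobius B0 phiB Bmin
  rotation_measure fin.
- by move=> k x y; rewrite !rotation_measure_ball.
- by move=> k x; rewrite rotation_measure_ball lte_fin divr_gt0 ?expV_gt0.
- exact: hk0.
exists sigma; split; [exact: sinv|exact: suniq|move=> A mA AB].
by rewrite sE'// !mu_bar_rotation.
Qed.

End CayleyTransform.

(** * Specialisation to Q_p(sqrt Delta) *)

Theorem theorem6p3 (R : realType) (p : nat) (K : padicFieldType R p)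
    (a b c d : K)
    (L : fieldExtType K) (absL : L -> R) (sqrtDelta : L)
    (mu0 : probability (borel K) R)
    (eta : K) (B : set (proj_line K)) :
  prime p -> (3 <= p)%N ->
  a * d - b * c != 0 ->
  (* L = Q_p(sqrt Delta), with the extended absolute value *)
  sqrtDelta ^+ 2 = ((d - a) ^+ 2 + 4 * b * c)%:A ->
  (<<1; sqrtDelta>>%VS = fullv) ->
  extends_padic_abs absL ->
  sqrtDelta \notin 1%VS ->
  (let lambda := ((a + d)%:A + sqrtDelta) / ((a + d)%:A - sqrtDelta) in
   forall n : nat, (0 < n)%N -> lambda ^+ n != 1) ->
  ramified absL ->
  (let r0 := absL (sqrtDelta / c%:A) in
   padic_abs eta = p%:R `^ (- 2^-1) * r0) ->
  haar_probability mu0 ->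
  let phi := mobius a b c d in
  let h := affine_map eta ((a - d) / (2 * c)) in
  minimal_subsystem phi B ->
  exists sigma : probability (borel (proj_line K)) R,
    [/\ invariant_probability phi B sigma,
        forall tau : probability (borel (proj_line K)) R,
          invariant_probability phi B tau ->
          forall A : set (borel (proj_line K)), measurable A -> A `<=` B ->
            tau A = sigma A
      & forall A : set (borel (proj_line K)), measurable A -> A `<=` B ->
          sigma A = (mu_bar mu0 (h @^-1` A) / mu_bar mu0 (h @^-1` B))%E].
Proof.
move=> p_pr p_ge3 _ s2 _ [hL ext] sNV lam _ etaE haar phi h Bmin.
pose iota : {rmorphism K -> L} := in_alg L.
have sNK x : sqrtDelta != iota x.
  by apply: contraNneq sNV => ->; rewrite /iota /= memvZ// mem1v.
have {}ext x : absL (iota x) = padic_abs x by exact: ext.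
have {}s2 : sqrtDelta ^+ 2 = iota ((d - a) ^+ 2 + 4 * b * c) by exact: s2.
have hv := @padic_abs_ultrametric R p K.
have c0 := c_neq0 s2 sNK.
have s0 : sqrtDelta != 0 by have := sNK 0; rewrite rmorph0.
have etaE' : padic_abs eta = p%:R `^ (- 2^-1) * (absL sqrtDelta / padic_abs c).
  by rewrite etaE (uabs_div hL) [absL c%:A]ext.
have powP : (p%:R `^ (- 2^-1) : R) ^+ 2 = p%:R^-1.
  rewrite -powR_mulrn ?powR_ge0// -powRrM mulNr mulVf ?pnatr_eq0//.
  by rewrite powR_inv1.
have sp : 0 < absL sqrtDelta by rewrite (uabs_gt0 hL).
have cp : 0 < padic_abs c by rewrite (uabs_gt0 hv).
have eta0 : eta != 0.
  rewrite -(uabs_gt0 hv) etaE' mulr_gt0 ?divr_gt0// powR_gt0//.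
  exact: natp_gt0.
have scale0 : iota (2 * c * eta) != 0.
  by rewrite fmorph_eq0 !mulf_neq0// (two_neq0 _ p_pr p_ge3).
(* The fixed point (a - d + sqrtDelta)/(2c) of [phi] has coordinate z = sqrtDelta/(2 c eta). *)
have thetaE : sqrtDelta = sqrtDelta / iota (2 * c * eta) * iota (2 * c * eta).
  by rewrite divfK.
(* The prescribed |eta| = p^(-1/2) |sqrtDelta/c| and |2| = 1 make this value the square root of
   p. *)
have theta2 : absL (sqrtDelta / iota (2 * c * eta)) ^+ 2 = p%:R.
  rewrite (uabs_div hL) ext !(uabsM hv) (abs2 _ p_pr p_ge3) mul1r.
  rewrite expr_div_n exprMn etaE' !exprMn powP exprVn.
  have P0 := natp_neq0 R p_pr; field.
  by rewrite (gt_eqF sp) (gt_eqF cp) P0.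
have mult1 n : (0 < n)%N -> cayley_mult iota a d sqrtDelta ^+ n != 1.
  by move=> n0; exact: lam.
exact: (mobius_uniquely_ergodic p_pr p_ge3 hL ext s2 sNK eta0 thetaE theta2 mult1 Bmin haar).
Qed.
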